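(* Let $E$ be a bounded measurable set in $\mathbb{R}^2$ with positive Lebesgue measure and rectifiable boundary of finite length. Then a translate of $E$ can be reconstructed using $2$ test sets.
   Context: The length of a set is its $1$-dimensional Hausdorff measure $\mathcal{H}^1$. A set is rectifiable if it can be covered by countably many Lipschitz curves and an $\mathcal{H}^1$-null set. Let $\lambda^2$ denote Lebesgue measure on $\mathbb{R}^2$. For a family $\mathcal{A}$ of Lebesgue measurable subsets of $\mathbb{R}^2$ of finite measure, an element of $\mathcal{A}$ can be reconstructed using $n$ test sets if there exist measurable sets $T_1,\ldots,T_n\subset\mathbb{R}^2$ such that whenever $A,B\in\mathcal{A}$ and $\lambda^2(A\cap T_i)=\lambda^2(B\cap T_i)$ for every $i=1,\ldots,n$, then $A=B$. ''A translate of $E$'' refers to the family $\{E+x:x\in\mathbb{R}^2\}$. *)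

(* Defs.v *)
From HB Require Import structures.
From mathcomp Require Import all_boot all_order all_algebra.
From mathcomp Require Import all_classical all_reals all_analysis.

Set Implicit Arguments.
Unset Strict Implicit.
Unset Printing Implicit Defensive.

Import Order.TTheory GRing.Theory Num.Theory.
Import numFieldNormedType.Exports.

Local Open Scope classical_set_scope.
Local Open Scope ring_scope.

(* Lebesgue measure on the plane as the completion of the Borel product measure
   [lebesgue_measure \x lebesgue_measure].  As a function it is the induced
   outer measure, defined on all sets; it is countably additive on the sets
   satisfying [lebesgue2_measurable]. *)
Definition lebesgue2 {R : realType} : set (R * R) -> \bar R :=
  @completed_measure_extension _ _ _
    ((@lebesgue_measure R) \x (@lebesgue_measure R))%E.

(* The Caratheodory sigma-algebra: all Lebesgue measurable sets, not only the
   Borel ones given by the canonical [measurable] on [R * R]. *)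
Definition lebesgue2_measurable {R : realType} : set (set (R * R)) :=
  (((@lebesgue_measure R) \x (@lebesgue_measure R))%E)^*%mu.-cara.-measurable.

(* The canonical norm on [R * R] is the max norm, hence an explicit Euclidean
   distance for diameters and Hausdorff measure. *)
Definition edist {R : realType} (p q : R * R) : R :=
  Num.sqrt ((p.1 - q.1) ^+ 2 + (p.2 - q.2) ^+ 2).

(* The maximum with 0 only matters for the empty set: [ereal_sup set0 = -oo]. *)
Definition ediam {R : realType} (U : set (R * R)) : \bar R :=
  maxe 0%E (ereal_sup [set (edist pq.1 pq.2)%:E | pq in U `*` U]).

Definition hausdorff1_pre {R : realType} (delta : R) (A : set (R * R)) :
    \bar R :=
  ereal_inf [set (\sum_(0 <= k <oo) ediam (U k))%E | U in
    [set U : nat -> set (R * R) |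
      (forall k, (ediam (U k) <= delta%:E)%E) /\ A `<=` \bigcup_k U k]].

Definition hausdorff1 {R : realType} (A : set (R * R)) : \bar R :=
  ereal_sup [set hausdorff1_pre delta A | delta in [set d : R | 0 < d]].

(* Being Lipschitz does not depend on the choice of norm on the plane, so the
   library notion (for the max norm) is used here. *)
Definition rectifiable {R : realType} (A : set (R * R)) : Prop :=
  exists gamma : nat -> R -> R * R, exists N : set (R * R),
    [/\ forall k, [lipschitz gamma k t | t in `[0, 1]%classic],
        hausdorff1 N = 0%E
      & A `<=` \bigcup_k (gamma k @` `[0, 1]%classic) `|` N].

Definition boundary {T : topologicalType} (A : set T) : set T :=
  closure A `\` interior A.

Definition translates {R : realType} (E : set (R * R)) : set (set (R * R)) :=
  [set [set p + x | p in E] | x in [set: R * R]].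

(* Meant for families of Lebesgue measurable sets of finite measure. *)
Definition reconstructible {R : realType} (n : nat)
    (F : set (set (R * R))) : Prop :=
  exists T : 'I_n -> set (R * R),
    (forall i, lebesgue2_measurable (T i)) /\
    forall A B, F A -> F B ->
      (forall i, lebesgue2 (A `&` T i) = lebesgue2 (B `&` T i)) -> A = B.

(* Main.v *)
Require Import Defs.
From HB Require Import structures.
From mathcomp Require Import all_boot all_order all_algebra.
From mathcomp Require Import all_classical all_reals all_analysis.
From mathcomp Require Import measurable_realfun ring lra zify.
Import Order.TTheory GRing.Theory Num.Theory.
Import numFieldNormedType.Exports.
Local Open Scope classical_set_scope.
Local Open Scope ring_scope.

(** A point x of the plane is determined by x.1 + a * x.2 and x.1 + b * x.2
    as soon as a <> b. So it suffices to find, for two slopes a, a test set T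
    such that the measure of (E + x) `&` T is a strictly increasing function
    of s := x.1 + a * x.2. The set T is a union of parallel lines, namely
    {p | p.1 + a * p.2 is in S} for some S on the line. If g t denotes the
    length of the section of the interior of E by the line p.1 + a * p.2 = t,
    the measure in question is
      F s = \int 1_S(t + s) g(t) dt,   F' s = - \int 1_S(t + s) dg(t).
    Were 1_S replaced by an increasing step function equal to c_k on ]k, k + 1],
    the derivative would be \sum_k (c_k - c_(k-1)) g(k - s) > 0. So S is built
    with density c_k in ]k, k + 1], from N_k equal intervals, and N_k is taken
    so that S is spread evenly enough there for F' to stay positive
    (exists_increasing_pattern, pattern_increasing).

    What is needed of N is uniform in the shift: if phi is nondecreasing and
    continuous, the measure dphi of {t in ]s, s + 1] | frac (N (t - s)) <= c}
    must be close to c (phi (s + 1) - phi s) for all s at once. As dphi may be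
    singular this is false for some large N, but it holds for a suitable one
    (equidistribution). Cut the support of dphi into p cells, p a large prime:
    under a random affine map modulo p the cells become pairwise independent,
    so that the variance of the mass sent into an arc is at most the largest
    mass of a cell, which is small by continuity (affine_second_moment). Since
    the variance is a mean of nonnegative terms, the multiplier may be confined
    to a small proportion of the residues (exists_good_multiplier), hence to
    frequencies so low that a cell is short compared with the period. Finally
    dphi >= 0 turns a bound for most phases into a bound for all of them: an
    arc is contained in slightly longer arcs of many neighbouring phases.

    It remains to write g as a difference of two nondecreasing continuous
    functions, that is, to see that g is continuous with bounded variation. If
    a horizontal segment joins a point of the interior to a point outside it,
    then it meets the boundary; so |g t' - g t| is at most the measure of the
    projection to the second axis of the part of the boundary lying between
    the lines t and t' (section_length_diff). Pairwise separated parts of the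
    boundary have projections of total measure at most a constant times its
    length (separated_projections), whence the bounded variation. It also
    follows that only countably many slopes have a line meeting the boundary
    in positive measure, because two lines of different slopes have a single
    common point (two_null_slopes); for all the other slopes g is continuous,
    and by Fubini the boundary is a null set of the plane, so that E may be
    replaced by its interior. *)

Set Implicit Arguments.
Unset Strict Implicit.
Unset Printing Implicit Defensive.

(** * Affine maps modulo a prime *)

(** For j <> k the map (M, t) |-> (M * j + t, M * k + t) is a bijection of the
    pairs of residues, so the cross terms are products of two vanishing sums:
    the values of a random affine map at distinct points are independent. *)
Lemma affine_second_moment (R : comNzRingType) (p' : nat) (w b : 'I_p'.+2 -> R) :
  prime p'.+2 -> \sum_x b x = 0 ->
  \sum_M \sum_t (\sum_j w j * b (M * j + t)) ^+ 2 =
  (p'.+2)%:R * (\sum_j w j ^+ 2) * (\sum_x b x ^+ 2).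
Proof.
move=> pp b0.
have cross j k : j != k -> \sum_M \sum_t b (M * j + t) * b (M * k + t) = 0.
  move=> jk.
  have u : k - j \is a GRing.unit.
    have nz : (k - j)%R != 0 by rewrite subr_eq0 eq_sym.
    have := @unitZpE p'.+2 (val (k - j)) isT; rewrite natr_Zp => ->.
    rewrite prime_coprime// gtnNdvd ?ltn_ord//.
    by rewrite lt0n; apply: contra nz => /eqP e; apply/eqP/val_inj.
  transitivity (\sum_M \sum_t b t * b (M * (k - j) + t)).
    apply: eq_bigr => M _; rewrite (reindex_inj (addrI (- (M * j)))) /=.
    apply: eq_bigr => t _; congr (b _ * b _); ring.
  rewrite exchange_big/= big1// => t _; rewrite -mulr_sumr.
  suff -> : \sum_M b (M * (k - j) + t) = \sum_x b x by rewrite b0 mulr0.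
  by rewrite [RHS](reindex_inj (addIr t)) [RHS](reindex_inj (mulIr u)).
have diag j : \sum_M \sum_t b (M * j + t) * b (M * j + t) = (p'.+2)%:R * \sum_x b x ^+ 2.
  transitivity (\sum_(M < p'.+2) \sum_x b x ^+ 2).
    apply: eq_bigr => M _; rewrite [RHS](reindex_inj (addrI (M * j))) /=.
    by apply: eq_bigr => t _; rewrite expr2.
  by rewrite sumr_const card_ord mulr_natl.
transitivity (\sum_j \sum_k w j * w k * \sum_M \sum_t b (M * j + t) * b (M * k + t)).
  transitivity (\sum_M \sum_t \sum_j \sum_k w j * w k * (b (M * j + t) * b (M * k + t))).
    apply: eq_bigr => M _; apply: eq_bigr => t _; rewrite expr2 big_distrl/=.
    apply: eq_bigr => j _; rewrite big_distrr/=.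
    apply: eq_bigr => k _; ring.
  under eq_bigr do rewrite exchange_big/=.
  rewrite exchange_big/=; apply: eq_bigr => j _.
  under eq_bigr do rewrite exchange_big/=.
  rewrite exchange_big/=; apply: eq_bigr => k _.
  rewrite mulr_sumr; apply: eq_bigr => M _; by rewrite mulr_sumr.
rewrite mulrAC [RHS]mulrC mulr_suml; apply: eq_bigr => j _.
rewrite (bigD1 j)//= diag [X in _ + X]big1 ?addr0 ?expr2//.
by move=> k kj; rewrite cross ?mulr0// eq_sym.
Qed.

(** Confining the multiplier to n of the p residues costs only a factor p / n,
    because the summands of the second moment are nonnegative. The factor [Q]
    is the length of the support to be cut into cells; see [arc_residue]. *)
Lemma exists_good_multiplier (R : realType) (I : finType) (p' n Q : nat)
    (w b : I -> 'I_p'.+2 -> R) :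
  prime p'.+2 -> (0 < n)%N -> (0 < Q)%N -> (n * Q < p'.+2)%N ->
  (forall i, \sum_x b i x = 0) -> (forall i x, `|b i x| <= 1) ->
  exists2 N, (0 < N <= n)%N & forall i,
    \sum_t (\sum_j w i j * b i (inZp (N * Q) * j + t)) ^+ 2 <=
    (p'.+2)%:R ^+ 2 * (\sum_i \sum_j w i j ^+ 2) / n%:R.
Proof.
move=> pp n0 Q0 nQp b0 b1.
pose S M := \sum_i \sum_t (\sum_j w i j * b i (M * j + t)) ^+ 2.
pose B : R := (p'.+2)%:R ^+ 2 * (\sum_i \sum_j w i j ^+ 2).
have S0 M : 0 <= S M by do 2 apply: sumr_ge0 => *; rewrite sqr_ge0.
have SB : \sum_M S M <= B.
  rewrite exchange_big/= /B mulr_sumr; apply: ler_sum => i _.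
  rewrite affine_second_moment// expr2 -!mulrA ler_pM2l ?ltr0n//.
  rewrite mulrC; apply: ler_wpM2r; first by apply: sumr_ge0 => *; rewrite sqr_ge0.
  have -> : p'.+2%:R = \sum_(x : 'I_p'.+2) 1 :> R by rewrite sumr_const card_ord.
  by apply: ler_sum => x _; rewrite -[leRHS](expr1n _ 2) -real_normK
    ?num_real// lerXn2r ?nnegrE.
pose f (k : 'I_n) : 'I_p'.+2 := inZp (k.+1 * Q).
have fv k : val (f k) = (k.+1 * Q)%N.
  by rewrite /= modn_small// (leq_ltn_trans _ nQp)// leq_mul2r ltn_ord orbT.
have finj : injective f.
  move=> k l /(congr1 val); rewrite !fv => /eqP.
  by rewrite eqn_pmul2r// => /eqP[] /val_inj.
have SfB : \sum_k S (f k) <= B.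
  apply: le_trans SB; rewrite -(big_imset _ (in2W finj))/=.
  by rewrite [leRHS](bigID [in f @: xpredT])/= lerDl sumr_ge0.
have [k kB] : exists k, S (f k) <= B / n%:R.
  apply/not_existsP => h; suff : \sum_(k < n) (B / n%:R) < \sum_k S (f k).
    rewrite sumr_const card_ord -[_ *+ n]mulr_natr divfK ?pnatr_eq0 -?lt0n//.
    by rewrite ltNge SfB.
  apply: ltr_sum; first by apply/hasP; exists (Ordinal n0); rewrite ?mem_index_enum.
  by move=> k _; rewrite ltNge; apply/negP/h.
exists k.+1; first by rewrite ltn_ord.
move=> i; apply: le_trans kB; rewrite /S (bigD1 i)//= lerDl.
by do 2 apply: sumr_ge0 => *; rewrite sqr_ge0.
Qed.

(** * Increments of monotone functions *)

Definition clamp {R : realType} (u v x : R) : R := Num.max u (Num.min x v).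

Lemma clamp_le {R : realType} (u v x : R) : u <= v -> clamp u v x <= v.
Proof. by move=> uv; rewrite /clamp ge_max uv ge_min lexx orbT. Qed.

Lemma clamp_ge {R : realType} (u v x : R) : u <= clamp u v x.
Proof. by rewrite /clamp le_max lexx. Qed.

Lemma clamp_low {R : realType} (u v x : R) : x <= u -> clamp u v x = u.
Proof. by move=> xu; rewrite /clamp max_l// ge_min xu. Qed.

Lemma clamp_high {R : realType} (u v x : R) : u <= v -> v <= x -> clamp u v x = v.
Proof. by move=> uv vx; rewrite /clamp min_r// max_r. Qed.

Lemma clamp_id {R : realType} (u v x : R) : u <= x -> x <= v -> clamp u v x = x.
Proof. by move=> ux xv; rewrite /clamp min_l// max_r. Qed.

Lemma clamp_homo {R : realType} (u v : R) : {homo clamp u v : x y / x <= y}.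
Proof. by move=> x y xy; rewrite /clamp le_max2// le_min2. Qed.

(** The clamped copies of [f] carry its increments on consecutive cells, and
    these add up to its increment on their union. Clamping replaces the
    restriction of the Stieltjes measure of [f] to a cell. *)
Lemma sum_clamp {R : realType} (f : R -> R) (u : nat -> R) (p : nat) (x : R) :
  {homo u : i j / (i <= j)%N >-> i <= j} ->
  \sum_(t < p) (f (clamp (u t) (u t.+1) x) - f (u t)) =
  f (clamp (u 0%N) (u p) x) - f (u 0%N).
Proof.
move=> um; elim: p => [|p IH]; first by rewrite big_ord0 /clamp max_l ?subrr// ge_min lexx orbT.
rewrite big_ord_recr/= IH.
have u0p : u 0%N <= u p by apply: um.
have upS : u p <= u p.+1 by apply: um.
have [xp|px] := leP x (u p).
  rewrite [clamp (u p) _ _]clamp_low// subrr addr0; congr (f _ - _).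
  by rewrite /clamp !min_l// (le_trans xp).
rewrite (clamp_high u0p (ltW px)) addrC addrA subrK; congr (f _ - _).
rewrite /clamp !max_r//; first by rewrite le_min (le_trans u0p (ltW px)) (le_trans u0p).
by rewrite le_min (ltW px).
Qed.

Lemma sum_increments_le {R : realType} (f : R -> R) (a b : nat -> R) (N : nat) :
  {homo f : x y / x <= y} -> (forall m, b m <= a m.+1) ->
  \sum_(m < N) (f (b m) - f (a m)) <= f (a N) - f (a 0%N).
Proof.
move=> fm ba; rewrite -(telescope_sumr (fun m => f (a m)) (leq0n N)) big_mkord.
by apply: ler_sum => m _; rewrite lerD2r fm.
Qed.

(** An interval charges only the cells that it meets, and disjoint intervals
    together charge a cell at most its own increment. *)
Lemma increments_le_cells {R : realType} (f : R -> R) (u a b : nat -> R) (p N : nat) :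
  {homo f : x y / x <= y} -> {homo u : i j / (i <= j)%N >-> i <= j} ->
  (forall x, f x = f (clamp (u 0%N) (u p) x)) ->
  (forall m, a m <= b m) -> (forall m, b m <= a m.+1) ->
  \sum_(m < N) (f (b m) - f (a m)) <=
  \sum_(t < p) (f (u t.+1) - f (u t)) *
    [exists m : 'I_N, (a m < u t.+1) && (u t < b m)]%:R.
Proof.
move=> fm um fc ab ba.
pose g t x := f (clamp (u t) (u t.+1) x).
have uS t : u t <= u t.+1 by apply: um.
have -> : \sum_(m < N) (f (b m) - f (a m)) =
    \sum_(m < N) \sum_(t < p) (g t (b m) - g t (a m)).
  apply: eq_bigr => m _.
  transitivity ((f (clamp (u 0%N) (u p) (b m)) - f (u 0%N)) -
                (f (clamp (u 0%N) (u p) (a m)) - f (u 0%N))).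
    by rewrite -!fc; ring.
  rewrite -!(sum_clamp f)// -sumrB; apply: eq_bigr => t _.
  by rewrite /g; ring.
rewrite exchange_big/=; apply: ler_sum => t _.
case: existsP => [_|h].
  rewrite mulr1; have gm : {homo g t : x y / x <= y}.
    by move=> x y xy; apply/fm/clamp_homo.
  apply: le_trans (sum_increments_le N gm ba) _.
  by rewrite lerB// fm// ?clamp_le// clamp_ge.
rewrite mulr0 big1// => m _; rewrite /g.
have : ~~ ((a m < u t.+1) && (u t < b m)) by apply/negP => k; apply: h; exists m.
rewrite negb_and -!leNgt => /orP[uam|bum].
  by rewrite !clamp_high ?subrr// (le_trans uam).
by rewrite !clamp_low ?subrr// (le_trans (ab m)).
Qed.

(** * Equidistribution of continuous increments *)

(** The cell [Q * j / p, Q * (j + 1) / p[ that meets the interval between the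
    phases [al] and [be] of the [m]-th period 1 / N after [s] has a residue
    N * Q * j modulo p close to that arc: it may fall outside by [k], the
    length of a cell counted in periods. A further slack [k] lets the phase be
    any integer point [z] of an interval of length k * p. *)
Lemma arc_residue (R : realType) (p' N Q j m K : nat) (t : 'I_p'.+2) (z : int)
    (k s al be : R) :
  (0 < N)%N ->
  (N * Q)%:R <= k * p'.+2%:R ->
  s + (m%:R + al) / N%:R < Q%:R * j.+1%:R / p'.+2%:R ->
  Q%:R * j%:R / p'.+2%:R < s + (m%:R + be) / N%:R ->
  p'.+2%:R * (N%:R * s + al - k) - k * p'.+2%:R <= z%:~R ->
  z%:~R <= p'.+2%:R * (N%:R * s + al - k) ->
  (p'.+2%:Z %| t%:Z + z)%Z ->
  (forall r : nat, r%:R < p'.+2%:R * (be - al + 2 * k) -> (r < K)%N) ->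
  (val ((inZp (N * Q) : 'I_p'.+2) * inZp j + t)%R < K)%N.
Proof.
move=> N0 NQk lo hi zlo zhi /dvdzP[l tz] rK.
have NR : 0 < N%:R :> R by rewrite ltr0n.
have pR : 0 < p'.+2%:R :> R by rewrite ltr0n.
set P : R := p'.+2%:R in NQk lo hi zlo zhi rK pR *.
have lo' : P * (N%:R * s + m%:R + al) < (N * Q * j)%:R + (N * Q)%:R.
  have := lo; rewrite ltr_pdivlMr// -(ltr_pM2l NR).
  have -> : N%:R * ((s + (m%:R + al) / N%:R) * P) = P * (N%:R * s + m%:R + al).
    by field; rewrite gt_eqF.
  by rewrite !natrM -natr1; lra.
have hi' : (N * Q * j)%:R < P * (N%:R * s + m%:R + be).
  have := hi; rewrite ltr_pdivrMr// -(ltr_pM2l NR).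
  have -> : N%:R * ((s + (m%:R + be) / N%:R) * P) = P * (N%:R * s + m%:R + be).
    by field; rewrite gt_eqF.
  by rewrite !natrM mulrA.
pose r : int := (N * Q * j)%:Z - z - p'.+2%:Z * m%:Z.
have rE : r%:~R = (N * Q * j)%:R - z%:~R - P * m%:R :> R.
  by rewrite /r !intrB intrM -!pmulrn.
have r0 : (0 : R) < r%:~R by rewrite rE; nra.
have rlt : r%:~R < P * (be - al + 2 * k) by rewrite rE; nra.
have {}r0 : 0 < r by rewrite -(ltr0z R).
have re : r = (`|r|%N)%:Z by rewrite gez0_abs// ltW.
have : (`|r| < K)%N by apply: rK; rewrite pmulrn -re.
apply: leq_ltn_trans.
suff -> : val ((inZp (N * Q) : 'I_p'.+2) * inZp j + t) = (`|r| %% p'.+2)%N.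
  exact: leq_mod.
rewrite /= modnMml modnMmr modnDml.
apply/eqP; rewrite -eqz_nat -!modz_nat eqz_mod_dvd -re /r.
apply/dvdzP; exists (l + m%:Z); rewrite mulrDl -tz PoszD; ring.
Qed.

(** These are the residues of opposites of consecutive integers just below
    p * y. *)
Lemma residue_run (R : realType) (p' n : nat) (k y : R) :
  (n < p'.+2)%N -> n%:R <= k * p'.+2%:R ->
  exists2 t : 'I_n -> 'I_p'.+2, injective t & forall j, exists2 z : int,
    p'.+2%:R * y - k * p'.+2%:R <= z%:~R <= p'.+2%:R * y &
    (p'.+2%:Z %| (t j)%:Z + z)%Z.
Proof.
set P := p'.+2 => np nk.
pose z (j : nat) : int := Num.floor (P%:R * y) - j%:Z.
have [zlo zhi] : (Num.floor (P%:R * y))%:~R <= P%:R * y /\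
   P%:R * y < (Num.floor (P%:R * y))%:~R + 1.
  have /andP[] := real_floor_itv (num_real (P%:R * y)).
  by rewrite intrD.
have tP (j : nat) : (`|((- z j) %% P)%Z|%N < P)%N.
  by rewrite -ltz_nat gez0_abs ?modz_ge0// ltz_mod.
have tE (j : nat) : (P%:Z %| `|((- z j) %% P)%Z|%N%:Z + z j)%Z.
  rewrite gez0_abs ?modz_ge0//.
  rewrite -[z j]opprK -eqz_mod_dvd opprK modz_mod//.
exists (fun j => Ordinal (tP j)).
  move=> i j /(congr1 val)/= e; apply/val_inj.
  have := tE i; have := tE j; rewrite e.
  set T := `|_|%N => h1 h2; have := rpredB h2 h1.
  have -> : T%:Z + z i - (T%:Z + z j) = j%:Z - i%:Z by rewrite /z; ring.
  rewrite -eqz_mod_dvd !modz_nat !modn_small ?eqz_nat; last 2 first.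
  - exact: ltn_trans (ltn_ord _) np.
  - exact: ltn_trans (ltn_ord _) np.
  by move=> /eqP.
move=> j; exists (z j); last exact: tE.
have jn : j.+1%:R <= n%:R :> R by rewrite ler_nat.
rewrite /z intrB -pmulrn; rewrite -natr1 in jn.
have j0 : 0 <= (j : nat)%:R :> R by [].
apply/andP; split; lra.
Qed.

(** One frequency serves finitely many functions and arcs. The run of good
    phases given by [residue_run] is long enough for one of its members to have
    a small deviation, and the arc of that phase, longer by 3 * k, contains the
    arc in question. *)
Lemma equidistribution_upper (R : realType) (I : finType) (Q : nat)
    (phi : I -> R -> R) (al be : I -> R) (eps : R) :
  (forall i, {homo phi i : x y / x <= y}) ->
  (forall i x, phi i x = phi i (clamp 0 Q%:R x)) ->
  (forall e : R, 0 < e -> exists2 d : R, 0 < d & forall i (x y : R),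
     x <= y -> y <= x + d -> phi i y - phi i x <= e) ->
  (forall i, [/\ 0 <= al i, al i <= be i & be i <= 1]) -> 0 < eps -> (0 < Q)%N ->
  exists2 N, (0 < N)%N & forall i s,
    \sum_(m < N) (phi i (s + (m%:R + be i) / N%:R) -
                  phi i (s + (m%:R + al i) / N%:R)) <=
    (be i - al i) * (phi i Q%:R - phi i 0) + eps.
Proof.
move=> phim phic phiu ab eps0 Q0.
have QR : 0 < Q%:R :> R by rewrite ltr0n.
pose A i := phi i Q%:R - phi i 0.
have A0 i : 0 <= A i by rewrite subr_ge0 phim.
pose SA := \sum_i A i.
have SA0 : 0 <= SA by rewrite sumr_ge0.
have ASA i : A i <= SA by rewrite /SA (bigD1 i)//= lerDl sumr_ge0.
(* length of a cell in periods; the arcs are enlarged by at most 3 * k in all *)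
pose k := Num.min (1/2) (eps / (6 * (SA + 1))).
have k0 : 0 < k by rewrite lt_min; apply/andP; split; [lra|rewrite divr_gt0//; nra].
have k12 : k <= 1/2 by rewrite ge_min lexx.
have kA i : 3 * k * A i <= eps / 2.
  have : k <= eps / (6 * (SA + 1)) by rewrite ge_min lexx orbT.
  rewrite ler_pdivlMr; last nra.
  by have := ASA i; nra.
(* bound on the mass of a cell, making the mean square deviation of a run at
   most (eps / 2) ^ 2 *)
pose v := (eps / 2 / (2 * Q%:R / k)) ^+ 2 / (SA + 1).
have v0 : 0 < v by rewrite divr_gt0 ?exprn_gt0 ?divr_gt0 ?mulr_gt0//; lra.
have [d d0 dP] := phiu v v0.
have [p0 [pp ple ped]] : exists p, [/\ prime p, Q%:R / k <= p%:R & Q%:R / d <= p%:R].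
  have [p pb pp] := prime_above (Num.truncn (Q%:R / k + Q%:R / d)).
  exists p; split => //; apply: le_trans (_ : (Num.truncn (Q%:R / k + Q%:R / d)).+1%:R <= _); rewrite ?ler_nat//.
    by apply: le_trans (ltW (truncnS_gt _)); rewrite lerDl divr_ge0 ?ltW.
  by apply: le_trans (ltW (truncnS_gt _)); rewrite lerDr divr_ge0 ?ltW.
case: p0 pp ple ped => [|[|p']] // pp ple ped.
set P := p'.+2 in pp ple ped *.
have PR : 0 < P%:R :> R by rewrite ltr0n.
(* number of admissible multipliers, and also of phases in a run *)
pose n := Num.truncn (k * P%:R / Q%:R).
have kPQ : 1 <= k * P%:R / Q%:R.
  by rewrite ler_pdivlMr// mul1r mulrC -ler_pdivrMr.
have n0 : (0 < n)%N by rewrite truncn_ge_nat// (le_trans _ kPQ).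
have nR : 0 < n%:R :> R by rewrite ltr0n.
have nQ : n%:R * Q%:R <= k * P%:R.
  by rewrite -ler_pdivlMr// truncn_le (le_trans _ kPQ).
have Pn : P%:R <= (2 * Q%:R / k) * n%:R.
  have : k * P%:R / Q%:R < n%:R + 1 by rewrite natr1 truncnS_gt.
  have n1 : 1 <= n%:R :> R by rewrite ler1n.
  rewrite ltr_pdivrMr// => h.
  rewrite mulrAC ler_pdivlMr// mulrC; nra.
have nQP : (n * Q < P)%N.
  by rewrite -(ltr_nat R) natrM (le_lt_trans nQ)//; nra.
have nP : (n < P)%N by apply: leq_ltn_trans nQP; rewrite leq_pmulr.
have nk : n%:R <= k * P%:R.
  by apply: le_trans nQ; rewrite ler_peMr// ler1n.
pose u (j : nat) : R := Q%:R * j%:R / P%:R.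
have um : {homo u : i j / (i <= j)%N >-> i <= j}.
  by move=> i j ij; rewrite /u ler_pM2r ?invr_gt0// ler_pM2l// ler_nat.
have u0 : u 0%N = 0 by rewrite /u mulr0 mul0r.
have uP : u P = Q%:R by rewrite /u mulfK// gt_eqF.
pose w i (j : 'I_P) := phi i (u j.+1) - phi i (u j).
have w0 i j : 0 <= w i j by rewrite subr_ge0 phim// um.
have wv i j : w i j <= v.
  apply: dP; first exact: um.
  rewrite /u -natr1 mulrDr mulr1 mulrDl lerD2l.
  by rewrite ler_pdivrMr// mulrC -ler_pdivrMr.
have wA i : \sum_j w i j = A i.
  by rewrite -(big_mkord xpredT (fun j => phi i (u j.+1) - phi i (u j))) telescope_sumr// uP u0.
pose l i := be i - al i + 2 * k.
pose K i := minn P (Num.truncn (P%:R * l i)).+1.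
have l0 i : 0 <= l i by rewrite /l; case: (ab i) => *; lra.
have KP i : (K i <= P)%N by rewrite geq_minl.
have KR i : (K i)%:R <= P%:R * l i + 1.
  apply: (@le_trans _ _ (Num.truncn (P%:R * l i)).+1%:R); first by rewrite ler_nat geq_minr.
  by rewrite -natr1 lerD2r truncn_le mulr_ge0// ltW.
(* indicator of an arc of K i residues, centred *)
pose b i (x : 'I_P) : R := (x < K i)%N%:R - (K i)%:R / P%:R.
have KP1 i : 0 <= ((K i)%:R : R) / P%:R <= 1.
  by rewrite divr_ge0//= ler_pdivrMr// mul1r ler_nat.
have bs i : \sum_x b i x = 0.
  rewrite sumrB sumr_const card_ord -[_ *+ P]mulr_natr divfK ?gt_eqF//.
  have -> : \sum_(x < P) (x < K i)%N%:R = (K i)%:R :> R.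
    transitivity (\sum_(x < P | (x < K i)%N) (1 : R)).
      by rewrite [RHS]big_mkcond/=; apply: eq_bigr => x _; case: ifP.
    by rewrite -(big_ord_widen P (fun=> 1 : R) (KP i)) sumr_const card_ord.
  by rewrite subrr.
have b1 i x : `|b i x| <= 1.
  rewrite /b; have /andP[? ?] := KP1 i.
  by case: (x < K i)%N; rewrite /= ?mulr1n ?mulr0n ler_norml; apply/andP; split; lra.
have [N /andP[N0 Nn] NP] := exists_good_multiplier w pp n0 Q0 nQP bs b1.
exists N => // i s.
have NR : 0 < N%:R :> R by rewrite ltr0n.
have [al0 albe be1] := ab i.
have NQk : (N * Q)%:R <= k * P%:R.
  by apply: le_trans nQ; rewrite natrM ler_pM2r// ler_nat.
have [t tinj tP] := residue_run (N%:R * s + al i - k) nP nk.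
pose X x := \sum_j w i j * b i (inZp (N * Q) * j + x).
have [j0 Xj0] : exists j, X (t j) <= eps / 2.
  apply/not_existsP => h.
  have h' j : (eps / 2) ^+ 2 < X (t j) ^+ 2.
    have /negP := h j; rewrite -ltNge => hj.
    by rewrite ltrXn2r ?nnegrE//; lra.
  have := NP i; apply/negP; rewrite -ltNge.
  have : \sum_(j < n) (eps / 2) ^+ 2 < \sum_x X x ^+ 2.
    apply: (@lt_le_trans _ _ (\sum_(j < n) X (t j) ^+ 2)).
      apply: ltr_sum => //; apply/hasP; exists (Ordinal n0) => //.
    rewrite -(big_imset (fun x => X x ^+ 2) (in2W tinj))/=.
    by rewrite [leRHS](bigID [in t @: xpredT])/= lerDl sumr_ge0// => *; rewrite sqr_ge0.
  apply: le_lt_trans.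
  rewrite sumr_const card_ord -[(eps / 2) ^+ 2 *+ n]mulr_natr.
  rewrite ler_pdivrMr//.
  have -> : (eps / 2) ^+ 2 * n%:R * n%:R = (eps / 2 * n%:R) ^+ 2 by ring.
  have S1 : \sum_i \sum_j w i j ^+ 2 <= v * (SA + 1).
    apply: (@le_trans _ _ (v * SA)); last by rewrite ler_pM2l//; lra.
    rewrite /SA mulr_sumr; apply: ler_sum => i' _.
    rewrite -wA mulr_sumr; apply: ler_sum => j _.
    by rewrite expr2 ler_wpM2r.
  have S2 : v * (SA + 1) = (eps / 2 / (2 * Q%:R / k)) ^+ 2.
    by rewrite /v divfK// gt_eqF//; lra.
  apply: (@le_trans _ _ (P%:R ^+ 2 * (eps / 2 / (2 * Q%:R / k)) ^+ 2)).
    by rewrite ler_pM2l ?exprn_gt0// -S2.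
  set C := 2 * Q%:R / k in Pn *.
  have C0 : 0 < C by rewrite divr_gt0 ?mulr_gt0.
  have e2 : 0 < eps / 2 by lra.
  have eC : 0 < eps / 2 / C by rewrite divr_gt0.
  rewrite -exprMn lerXn2r// ?nnegrE; try by rewrite mulr_ge0 ?ltW.
  have -> : P%:R * (eps / 2 / C) = eps / 2 * (P%:R / C) by ring.
  by rewrite ler_pM2l// ler_pdivrMr// mulrC.
have [z /andP[zlo zhi] zt] := tP j0.
have L1 : \sum_(m < N) (phi i (s + (m%:R + be i) / N%:R) -
     phi i (s + (m%:R + al i) / N%:R)) <=
   \sum_j w i j * (val ((inZp (N * Q) : 'I_P) * j + t j0)%R < K i)%N%:R.
  pose a' m : R := s + (m%:R + al i) / N%:R.
  pose b' m : R := s + (m%:R + be i) / N%:R.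
  have ab' m : a' m <= b' m by rewrite lerD2l ler_pM2r ?invr_gt0// lerD2l.
  have ba' m : b' m <= a' m.+1.
    by rewrite lerD2l ler_pM2r ?invr_gt0// -natr1; lra.
  have phic' x : phi i x = phi i (clamp (u 0%N) (u P) x) by rewrite u0 uP.
  apply: le_trans (increments_le_cells N (phim i) um phic' ab' ba') _.
  apply: ler_sum => j _; apply: ler_wpM2l; first exact: w0.
  case: (boolP [exists m : 'I_N, (a' m < u j.+1) && (u j < b' m)]); last by rewrite ler_nat.
  move=> /existsP[m /andP[am bm]].
  rewrite -[j in inZp _ * j]valZpK /K leq_min ltn_ord/=.
  rewrite (arc_residue N0 NQk am bm zlo zhi zt)// => r rl.
  by rewrite ltnS truncn_ge_nat ?(ltW rl)// mulr_ge0// ltW.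
apply: le_trans L1 _.
have -> : \sum_j w i j * (val ((inZp (N * Q) : 'I_P) * j + t j0)%R < K i)%N%:R =
    X (t j0) + (K i)%:R / P%:R * A i.
  rewrite -wA mulr_sumr -big_split/=; apply: eq_bigr => j _.
  by rewrite /b; ring.
rewrite addrC.
have : (K i)%:R / P%:R * A i <= (be i - al i + 3 * k) * A i.
  rewrite ler_wpM2r// ler_pdivrMr// (le_trans (KR i))// /l.
  have : 1 <= k * P%:R by rewrite (le_trans _ nk)// ler1n.
  lra.
have := kA i; rewrite -/(A i); nra.
Qed.

Lemma clamp_lip (R : realType) (u v x y : R) : x <= y ->
  clamp u v y - clamp u v x <= y - x.
Proof.
move=> xy; rewrite /clamp.
case: (leP x v) => ?; case: (leP y v) => ?; case: (leP u x) => ?;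
case: (leP u y) => ?; case: (leP u v) => ?; lra.
Qed.

(** Clamping the values of [phi] between those at the ends of a window reduces
    the increments over [s, s + 1] to total increments; finitely many windows
    suffice. The lower bound is the upper bound for the complementary arc. *)
Lemma equidistribution (R : realType) (Q : nat) (phi : bool -> R -> R) (c eps : R) :
  (forall i, {homo phi i : x y / x <= y}) ->
  (forall i x, phi i x = phi i (clamp 0 Q%:R x)) ->
  (forall e : R, 0 < e -> exists2 d : R, 0 < d & forall i (x y : R),
     x <= y -> y <= x + d -> phi i y - phi i x <= e) ->
  0 <= c <= 1 -> 0 < eps -> (0 < Q)%N ->
  exists2 N, (0 < N)%N & forall i s,
    `|\sum_(m < N) (phi i (s + (m%:R + c) / N%:R) - phi i (s + m%:R / N%:R)) -
      c * (phi i (s + 1) - phi i s)| <= eps.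
Proof.
move=> phim phic phiu /andP[c0 c1] eps0 Q0.
have QR : 0 < Q%:R :> R by rewrite ltr0n.
have e4 : 0 < eps / 4 by lra.
have [h h0 hP] := phiu _ e4.
pose K := (Num.truncn ((Q%:R + 1) / h)).+1.
pose bot (i : nat) := i%:R * h - 1.
pose top (i : nat) := bot i + 1 + h.
have bt i : bot i <= top i by rewrite /top; lra.
pose I : finType := (bool * 'I_K * bool)%type.
(* the window from bot to top contains [s, s + 1] and is longer by h only *)
pose psi (i : I) x := clamp (phi i.1.1 (bot i.1.2)) (phi i.1.1 (top i.1.2)) (phi i.1.1 x).
pose al (i : I) := if i.2 then c else 0.
pose be (i : I) := if i.2 then 1 else c.
have psim i : {homo psi i : x y / x <= y}.
  by move=> x y xy; apply/clamp_homo/phim.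
have [|||||N N0 NP] := @equidistribution_upper R I Q psi al be (eps / 2) psim.
- by move=> i x; rewrite /psi [X in clamp _ _ X]phic.
- move=> e e0; have [d d0 dP] := phiu e e0; exists d => // i x y xy yd.
  by apply: le_trans (dP i.1.1 x y xy yd); apply/clamp_lip/phim.
- by move=> i; rewrite /al /be; case: i.2.
- by lra.
- by [].
exists N => // i s.
have NR : 0 < N%:R :> R by rewrite ltr0n.
pose D := phi i (s + 1) - phi i s.
have N1 (m : 'I_N) (x : R) : 0 <= x <= 1 -> 0 <= (m%:R + x) / N%:R <= 1.
  move=> /andP[x0 x1]; apply/andP; split; first by rewrite divr_ge0 ?addr_ge0 ?(ltW NR).
  by rewrite ler_pdivrMr// mul1r (@le_trans _ _ m.+1%:R) ?ler_nat// -natr1 lerD2l.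
have key (j : bool) (a b : R) : a = (if j then c else 0) -> b = (if j then 1 else c) ->
    \sum_(m < N) (phi i (s + (m%:R + b) / N%:R) - phi i (s + (m%:R + a) / N%:R)) <=
    (b - a) * D + eps.
  move=> aE bE.
  have a01 : 0 <= a <= 1 by rewrite aE; case: j {aE bE}; lra.
  have b01 : 0 <= b <= 1 by rewrite bE; case: j {aE bE}; lra.
  have ab : a <= b by rewrite aE bE; case: j {aE bE}; lra.
  have D0 : 0 <= D by rewrite subr_ge0 phim//; lra.
  have RHS0 : 0 <= (b - a) * D + eps by rewrite addr_ge0 ?mulr_ge0//; lra.
  have [sN1|sN1] := leP s (-1).
    rewrite big1// => m _.
    have /andP[? ?] := N1 m _ a01; have /andP[? ?] := N1 m _ b01.
    by rewrite phic [X in _ - X]phic !clamp_low ?subrr//; lra.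
  have [sQ|sQ] := leP Q%:R s.
    rewrite big1// => m _.
    have /andP[? ?] := N1 m _ a01; have /andP[? ?] := N1 m _ b01.
    by rewrite phic [X in _ - X]phic !clamp_high ?subrr//; lra.
  pose k := Num.truncn ((s + 1) / h).
  have s10 : 0 <= (s + 1) / h by rewrite divr_ge0//; lra.
  have kK : (k < K)%N.
    by rewrite ltnS le_truncn// ler_pM2r ?invr_gt0//; lra.
  have /andP[klo khi] := truncn_itv s10.
  rewrite -/k ler_pdivlMr// in klo; rewrite -/k ltr_pdivrMr// -natr1 in khi.
  pose x : I := (i, Ordinal kK, j).
  have bots : bot k <= s by rewrite /bot; lra.
  have tops : s + 1 <= top k by rewrite /top /bot; lra.
  have psiE (y : R) : 0 <= y <= 1 -> psi x (s + y) = phi i (s + y).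
    by move=> /andP[y0 y1]; rewrite /psi clamp_id// phim//=; lra.
  have := NP x s.
  have -> : al x = a by rewrite aE.
  have -> : be x = b by rewrite bE.
  under eq_bigr do rewrite !psiE ?N1//.
  move=> /le_trans; apply.
  have m1 : psi x Q%:R - psi x 0 <= phi i (top k) - phi i (bot k).
    by rewrite lerB// ?clamp_ge// clamp_le// phim.
  have m2 : phi i (top k) - phi i (s + 1) <= eps / 4 by apply: hP => //; rewrite /top /bot; lra.
  have m3 : phi i s - phi i (bot k) <= eps / 4 by apply: hP => //; rewrite /bot; lra.
  have m4 : psi x Q%:R - psi x 0 <= D + eps / 2 by rewrite /D; lra.
  have ab1 : b - a <= 1 by lra.
  have ab0 : 0 <= b - a by lra.
  have : (b - a) * (psi x Q%:R - psi x 0) <= (b - a) * (D + eps / 2) by rewrite ler_wpM2l.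
  have : (b - a) * (eps / 2) <= 1 * (eps / 2) by rewrite ler_wpM2r//; lra.
  rewrite mulrDr; lra.
have up := key false 0 c erefl erefl.
have lo := key true c 1 erefl erefl.
have tel : \sum_(m < N) (phi i (s + (m%:R + 1) / N%:R) - phi i (s + m%:R / N%:R)) = D.
  under eq_bigr do rewrite natr1.
  rewrite -(big_mkord xpredT (fun m => phi i (s + m.+1%:R / N%:R) - phi i (s + m%:R / N%:R))).
  by rewrite (telescope_sumr (fun m => phi i (s + m%:R / N%:R)))// divff ?gt_eqF// mul0r addr0.
have spl : \sum_(m < N) (phi i (s + (m%:R + 1) / N%:R) - phi i (s + (m%:R + c) / N%:R)) +
   \sum_(m < N) (phi i (s + (m%:R + c) / N%:R) - phi i (s + m%:R / N%:R)) = D.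
  by rewrite -tel -big_split/=; apply: eq_bigr => m _; ring.
have up' :
    \sum_(m < N) (phi i (s + (m%:R + c) / N%:R) - phi i (s + m%:R / N%:R)) <=
    (c - 0) * D + eps.
  by apply: le_trans up; apply: ler_sum => m _; rewrite addr0.
rewrite -/D ler_norml; apply/andP; split; nra.
Qed.

(** * Sets of increasing density on the line *)

(** Any increasing sequence with values in ]0, 1[ would do; the increments of
    this one have the explicit lower bound [density_increment]. *)
Definition density (R : realType) (k : int) : R := (1 + k%:~R / (1 + `|k%:~R|)) / 2.

Lemma density_gt0 (R : realType) k : 0 < density R k.
Proof.
rewrite /density; set x : R := k%:~R; have h : 0 < 1 + `|x| by have := normr_ge0 x; lra.
rewrite divr_gt0// -(pmulr_lgt0 _ h) mulrDl divfK ?gt_eqF// mul1r.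
have := lerNnormlW (lexx `|x|); lra.
Qed.

Lemma density_lt1 (R : realType) k : density R k < 1.
Proof.
rewrite /density; set x : R := k%:~R; have h : 0 < 1 + `|x| by have := normr_ge0 x; lra.
rewrite ltr_pdivrMr// mul1r.
suff : x / (1 + `|x|) < 1 by lra.
by rewrite ltr_pdivrMr// mul1r; have := ler_norm x; lra.
Qed.

(** The increment is 1 / (2 n (n + 1)), where n is the larger of |k| and
    |k - 1|. *)
Lemma density_increment (R : realType) (k : int) :
  (2 * (`|k%:~R| + 2) ^+ 2)^-1 <= density R k - density R (k - 1).
Proof.
rewrite /density intrB; set x : R := k%:~R.
have [k0|k0] := leP k 0.
  have x0 : x <= 0 by rewrite lerz0.
  rewrite !ler0_norm; [|lra|lra].
  have -> : (1 + x / (1 + - x)) / 2 - (1 + (x - 1) / (1 + - (x - 1))) / 2 =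
     (2 * ((1 - x) * (2 - x)))^-1 by field; apply/andP; split; rewrite gt_eqF//; lra.
  rewrite lef_pV2 ?posrE; nra.
have x1 : 1 <= x by rewrite ler1z.
rewrite !ger0_norm; [|lra|lra].
have -> : (1 + x / (1 + x)) / 2 - (1 + (x - 1) / (1 + (x - 1))) / 2 =
   (2 * ((1 + x) * x))^-1 by field; apply/andP; split; rewrite gt_eqF//; lra.
rewrite lef_pV2 ?posrE; nra.
Qed.

Lemma summation_by_parts (R : realType) (c y : int -> R) (j : int) (n : nat) :
  \sum_(i < n) c (j + i%:Z) * (y (j + i%:Z) - y (j + i%:Z + 1)) =
  \sum_(i < n) (c (j + i%:Z) - c (j + i%:Z - 1)) * y (j + i%:Z) +
  c (j - 1) * y j - c (j + n%:Z - 1) * y (j + n%:Z).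
Proof.
elim: n => [|n IH]; first by rewrite !big_ord0 addr0 add0r subrr.
rewrite !big_ord_recr/= IH.
have -> : j + n.+1 = j + n%:Z + 1 by lia.
rewrite addrK; ring.
Qed.

Lemma int_window (j k : int) (n : nat) : j <= k -> k < j + n%:Z ->
  exists2 i : 'I_n, k = j + i%:Z & forall l : 'I_n, `|k - (j + l%:Z)| <= n%:Z.
Proof.
move=> jk kj; have iP : (`|k - j|%N < n)%N by lia.
exists (Ordinal iP) => [/=|l]; first by lia.
by have := ltn_ord l; lia.
Qed.

(** The sum is the derivative at [s] of the measure of a pattern, see
    [is_derive_pattern]. Up to the equidistribution errors it is
    \sum_k density k * (g (k - s) - g (k + 1 - s)), which by parts becomes
    \sum_k (density k - density (k - 1)) * g (k - s); all these terms are
    nonnegative, and one of them is at least c0 times an increment of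
    [density], since some k - s lies in the unit interval where g >= c0. The
    errors are chosen small against the increments at all k in reach. *)
Lemma exists_increasing_pattern (R : realType) (Q : nat) (phi : bool -> R -> R)
    (g : R -> R) (c0 t0 : R) :
  (forall i, {homo phi i : x y / x <= y}) ->
  (forall i x, phi i x = phi i (clamp 0 Q%:R x)) ->
  (forall e : R, 0 < e -> exists2 d : R, 0 < d & forall i (x y : R),
     x <= y -> y <= x + d -> phi i y - phi i x <= e) ->
  (0 < Q)%N ->
  (forall x, g x = phi true x - phi false x) ->
  (forall x, 0 <= g x) -> (forall x, x <= 0 \/ Q%:R <= x -> g x = 0) ->
  0 < c0 -> (forall x, t0 <= x <= t0 + 1 -> c0 <= g x) ->
  exists2 N : int -> nat, (forall k, (0 < N k)%N) & forall (j : int) (s : R),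
    j%:~R <= s <= j%:~R + 1 ->
    0 < \sum_(i < Q.+2) \sum_(m < N (j + i%:Z))
       (g ((j + i%:Z)%:~R + m%:R / (N (j + i%:Z))%:R - s) -
        g ((j + i%:Z)%:~R + (m%:R + density R (j + i%:Z)) / (N (j + i%:Z))%:R - s)).
Proof.
move=> phim phic phiu Q0 gE g0 gz c00 gc.
have [q q0 qE] : exists2 q : R, 0 <= q & Q.+2%:Z%:~R = q by exists Q.+2%:R.
(* lower bound for the increments of density at distance at most q from k *)
pose D (k : int) : R := (2 * (`|k%:~R| + q + 2) ^+ 2)^-1.
have D0 k : 0 < D k.
  rewrite invr_gt0 mulr_gt0// exprn_gt0//.
  by have := normr_ge0 (k%:~R : R); lra.
have [r r0 rE] : exists2 r : R, 0 < r & r = Q.+3%:R by exists Q.+3%:R.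
pose e k := c0 * D k / (2 * r).
have e0 k : 0 < e k by rewrite divr_gt0 ?mulr_gt0.
have d01 k : 0 <= density R k <= 1 by rewrite !ltW ?density_gt0 ?density_lt1.
have /choice[N NP] k : exists N, (0 < N)%N /\ forall i s,
    `|\sum_(m < N) (phi i (s + (m%:R + density R k) / N%:R) - phi i (s + m%:R / N%:R)) -
      density R k * (phi i (s + 1) - phi i s)| <= e k.
  by have [N ? ?] := equidistribution phim phic phiu (d01 k) (e0 k) Q0; exists N.
exists N => [k|j s /andP[js sj]]; first by case: (NP k).
pose y (k : int) := g (k%:~R - s).
have cell k : density R k * (y k - y (k + 1)) - 2 * e k <=
   \sum_(m < N k) (g (k%:~R + m%:R / (N k)%:R - s) -
        g (k%:~R + (m%:R + density R k) / (N k)%:R - s)).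
  have [_ h] := NP k.
  have := h true (k%:~R - s); have := h false (k%:~R - s).
  rewrite /y intrD !gE.
  have -> : \sum_(m < N k) (g (k%:~R + m%:R / (N k)%:R - s) -
        g (k%:~R + (m%:R + density R k) / (N k)%:R - s)) =
     \sum_(m < N k) (phi false (k%:~R - s + (m%:R + density R k) / (N k)%:R) -
        phi false (k%:~R - s + m%:R / (N k)%:R)) -
     \sum_(m < N k) (phi true (k%:~R - s + (m%:R + density R k) / (N k)%:R) -
        phi true (k%:~R - s + m%:R / (N k)%:R)).
    rewrite -sumrB; apply: eq_bigr => m _; rewrite !gE.
    rewrite ![k%:~R + _ - s]addrAC; ring.
  have -> : k%:~R + 1%:~R - s = k%:~R - s + 1 by ring.
  rewrite !ler_norml => /andP[? ?] /andP[? ?]; lra.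
apply: (@lt_le_trans _ _ (\sum_(i < Q.+2)
    (density R (j + i%:Z) * (y (j + i%:Z) - y (j + i%:Z + 1)) - 2 * e (j + i%:Z))));
  last by apply: ler_sum => i _.
rewrite sumrB summation_by_parts.
have -> : y j = 0 by apply: gz; left; lra.
have -> : y (j + Q.+2%:Z) = 0.
  by apply: gz; right; rewrite intrD -pmulrn -natr1 -natr1; lra.
rewrite !mulr0 addr0 subr0 subr_gt0.
pose k := Num.ceil (t0 + s).
have [kl kh] : k%:~R - 1 < t0 + s /\ t0 + s <= k%:~R.
  have /andP[] := real_ceil_itv (num_real (t0 + s)).
  by rewrite intrB.
have ky : c0 <= y k by apply: gc; lra.
have k1 : 0 < k%:~R - s.
  by rewrite ltNge; apply/negP => h; move: ky; rewrite /y gz; [lra|left].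
have k2 : k%:~R - s < Q%:R.
  by rewrite ltNge; apply/negP => h; move: ky; rewrite /y gz; [lra|right].
have jk : (j <= k)%R by rewrite -(ler_int R); lra.
have kj : (k < j + Q.+2%:Z)%R.
  by rewrite -(ltr_int R) intrD -pmulrn -natr1 -natr1; lra.
(* k is the index whose cell hits the unit interval where g >= c0 *)
have [i0 kE kW] := int_window jk kj.
pose X := (2 * (`|k%:~R : R| + 2) ^+ 2)^-1.
have X0 : 0 < X.
  by rewrite invr_gt0 mulr_gt0// exprn_gt0//; have := normr_ge0 (k%:~R : R); lra.
apply: (@lt_le_trans _ _ (c0 * X)).
  have De (i : 'I_Q.+2) : D (j + i%:Z) <= X.
    rewrite /D lef_pV2 ?posrE; last 2 first.
    - by rewrite mulr_gt0// exprn_gt0//; have := normr_ge0 ((j + i%:Z)%:~R : R); lra.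
    - by rewrite -invr_gt0.
    rewrite ler_pM2l// lerXn2r ?nnegrE ?addr_ge0 ?addr_ge0 ?normr_ge0// lerD2r.
    have -> : k%:~R = (j + i%:Z)%:~R + (k - (j + i%:Z))%:~R :> R.
      by rewrite -intrD addrCA subrr addr0.
    apply: le_trans (ler_normD _ _) _; rewrite lerD2l.
    by rewrite -intr_norm -qE ler_int.
  apply: (@le_lt_trans _ _ (\sum_(i < Q.+2) (c0 * X / r))).
    apply: ler_sum => i _; rewrite /e.
    have -> : 2 * (c0 * D (j + i%:Z) / (2 * r)) = c0 * D (j + i%:Z) / r.
      by field; rewrite gt_eqF.
    by rewrite ler_pM2r ?invr_gt0// ler_pM2l.
  rewrite sumr_const card_ord -[(_ / _) *+ _]mulr_natr mulrAC.
  by rewrite ltr_pdivrMr// ltr_pM2l ?mulr_gt0// rE ltr_nat.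
rewrite (bigD1 i0)//= -kE.
rewrite -[leLHS]addr0 lerD//.
  by rewrite mulrC; apply: ler_pM; rewrite ?(ltW X0) ?(ltW c00) ?density_increment.
apply: sumr_ge0 => i _; rewrite mulr_ge0// ?g0//.
apply: le_trans (density_increment _ _); by rewrite invr_ge0 mulr_ge0// exprn_ge0// addr_ge0.
Qed.

Definition piece (R : realType) (N : int -> nat) (k : int) (m : nat) : interval R :=
  `]k%:~R + m%:R / (N k)%:R, k%:~R + (m%:R + density R k) / (N k)%:R].

Definition pattern (R : realType) (N : int -> nat) : set R :=
  \bigcup_(k : int) \bigcup_(m in [set m | (m < N k)%N]) [set` piece R N k m].

Lemma measurable_pattern (R : realType) (N : int -> nat) :
  measurable (pattern N : set (measurableTypeR R)).
Proof.
apply: countable_bigcupT_measurable; first exact: countableP.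
by move=> k; apply: bigcup_measurable => m _; exact: measurable_itv.
Qed.

Lemma piece_bounds (R : realType) (N : int -> nat) (k : int) (m : nat) (t : R) :
  (m < N k)%N -> t \in piece R N k m ->
  [/\ k%:~R < t, t <= k%:~R + 1, m%:R < (t - k%:~R) * (N k)%:R &
      (t - k%:~R) * (N k)%:R <= m%:R + 1].
Proof.
move=> mN; rewrite in_itv/= => /andP[lo hi].
have N0 : 0 < (N k)%:R :> R by rewrite ltr0n (leq_ltn_trans _ mN).
have m0 : 0 <= m%:R :> R by [].
have d1 := density_lt1 R k.
have lo' : m%:R < (t - k%:~R) * (N k)%:R by rewrite -ltr_pdivrMr// ltrBrDl.
have hi' : (t - k%:~R) * (N k)%:R <= m%:R + density R k by rewrite -ler_pdivlMr// lerBlDl.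
have mN1 : m%:R + 1 <= (N k)%:R :> R by rewrite natr1 ler_nat.
split => //; last by lra.
- by rewrite -subr_gt0 -(pmulr_lgt0 _ N0); lra.
- by rewrite -lerBlDl -(ler_pM2r N0); lra.
Qed.

Lemma piece_inj (R : realType) (N : int -> nat) (k k' : int) (m m' : nat) (t : R) :
  (m < N k)%N -> (m' < N k')%N -> t \in piece R N k m -> t \in piece R N k' m' ->
  k = k' /\ m = m'.
Proof.
move=> mN mN' /(piece_bounds mN)[k1 k2 m1 m2] /(piece_bounds mN')[k1' k2' m1' m2'].
have kk : k = k'.
  have : k < k' + 1 by rewrite -(ltr_int R) intrD; lra.
  have : k' < k + 1 by rewrite -(ltr_int R) intrD; lra.
  by move=> h1 h2; clear -h1 h2; lia.
move: m1' m2'; rewrite -kk => m1' m2'; split => //.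
have : (m < m'.+1)%N by rewrite -(ltr_nat R) -natr1; lra.
have : (m' < m.+1)%N by rewrite -(ltr_nat R) -natr1; lra.
by move=> h1 h2; clear -h1 h2; lia.
Qed.

(** For s in [j, j + 1] only the Q + 2 cells from j on can meet the support
    ]0, Q] of the shifted measure. *)
Lemma measure_pattern (R : realType) (N : int -> nat) (Q : nat) (G : R -> R)
    (nu : {measure set (measurableTypeR R) -> \bar R}) (j : int) (s : R) :
  (forall a b : R, a <= b -> nu `]a, b]%classic = (G b - G a)%:E) ->
  nu (~` `]0, Q%:R]%classic) = 0%E ->
  j%:~R <= s <= j%:~R + 1 ->
  nu [set t | pattern N (t + s)] =
  (\sum_(i < Q.+2) \sum_(m < N (j + i%:Z))
    (G ((j + i%:Z)%:~R + (m%:R + density R (j + i%:Z)) / (N (j + i%:Z))%:R - s) -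
     G ((j + i%:Z)%:~R + m%:R / (N (j + i%:Z))%:R - s)))%:E.
Proof.
move=> nuE nu0 /andP[js sj].
pose J (i m : nat) : set (measurableTypeR R) :=
  `]((j + i%:Z)%:~R + m%:R / (N (j + i%:Z))%:R - s),
    ((j + i%:Z)%:~R + (m%:R + density R (j + i%:Z)) / (N (j + i%:Z))%:R - s)]%classic.
have JE i m t : J i m t <-> t + s \in piece R N (j + i%:Z) m.
  by rewrite /J /= !in_itv/= ltrBlDr lerBrDr.
have mJ i m : measurable (J i m) by exact: measurable_itv.
pose B : set (measurableTypeR R) := \big[setU/set0]_(i < Q.+2) \big[setU/set0]_(m < N (j + i%:Z)) J i m.
have BE : B = \bigcup_(i < Q.+2) \bigcup_(m < N (j + i%:Z)%R) J i m.
  by rewrite bigcup_mkord; apply: eq_bigr => i _; rewrite bigcup_mkord.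
have mB : measurable B by do 2 apply: bigsetU_measurable => ? _.
have nuB : nu B = (\sum_(i < Q.+2) \sum_(m < N (j + i%:Z))
    (G ((j + i%:Z)%:~R + (m%:R + density R (j + i%:Z)) / (N (j + i%:Z))%:R - s) -
     G ((j + i%:Z)%:~R + m%:R / (N (j + i%:Z))%:R - s)))%:E.
  rewrite /B (measure_bigsetU_ord nu xpredT); last 2 first.
  - by move=> i; apply: bigsetU_measurable => ? _.
  - apply/trivIsetP => i i' _ _ ii'; apply/seteqP; split => // t [].
    rewrite -!bigcup_mkord => -[m /= mN /JE h] [m' /= mN' /JE h'].
    have [e _] := piece_inj mN mN' h h'.
    have /val_inj e' : i = i' :> nat by move: e; clear; lia.
    by move: ii'; rewrite e' eqxx.
  rewrite -sumEFin; apply: eq_bigr => i _.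
  rewrite (measure_bigsetU_ord nu xpredT)//; last first.
    apply/trivIsetP => m m' _ _ mm'; apply/seteqP; split => // t [/JE h /JE h'].
    have [_ e] := piece_inj (ltn_ord m) (ltn_ord m') h h'.
    by move: mm'; rewrite (val_inj e) eqxx.
  rewrite -sumEFin; apply: eq_bigr => m _.
  apply: nuE; rewrite lerD2r lerD2l ler_wpM2r ?invr_ge0// lerDl.
  exact/ltW/density_gt0.
have mA : measurable ([set t | pattern N (t + s)] : set (measurableTypeR R)).
  have mf : measurable_fun setT ((fun t => t + s) : measurableTypeR R -> measurableTypeR R).
    exact: measurable_funD.
  by rewrite -[X in measurable X]setTI; apply: mf => //; exact: measurable_pattern.
pose I : set (measurableTypeR R) := `]0, Q%:R]%classic.
have mI : measurable I by exact: measurable_itv.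
have restr (A : set (measurableTypeR R)) : measurable A -> nu A = nu (A `&` I).
  move=> {}mA; rewrite -[A in LHS](setUIDK A I).
  rewrite measureU0//; [exact: measurableI|exact: measurableD|].
  apply: (subset_measure0 _ _ _ nu0); [exact: measurableD|exact: measurableC|].
  by move=> t [].
rewrite -nuB restr// [RHS]restr//; congr (nu _); apply/seteqP; split => t [tA tI]; split => //.
  move: tI; rewrite /I/= in_itv/= => /andP[t0 tQ].
  have [k _ [m /= mN tp]] := tA.
  have [k1 k2 _ _] := piece_bounds mN tp.
  have jk : j <= k.
    have : j < k + 1 by rewrite -(ltr_int R) intrD; lra.
    by move=> h; clear -h; lia.
  have kj : k < j + Q.+2%:Z.
    by rewrite -(ltr_int R) intrD -pmulrn -natr1 -natr1; lra.
  have [i kE _] := int_window jk kj.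
  rewrite BE; exists (i : nat); first exact: ltn_ord.
  exists m => /=; rewrite -?kE//.
  by apply/JE; rewrite -kE.
move: tA; rewrite BE => -[i /= iQ] [m /= mN /JE h].
by exists (j + i%:Z) => //; exists m.
Qed.

Lemma is_derive_pattern (R : realType) (G g : R -> R) (n : nat) (M : 'I_n -> nat)
    (al be : forall i : 'I_n, 'I_(M i) -> R) (s : R) :
  (forall x : R, is_derive x 1 G (g x)) ->
  is_derive s 1 (fun s => \sum_(i < n) \sum_(m < M i) (G (be i m - s) - G (al i m - s)))
    (\sum_(i < n) \sum_(m < M i) (g (al i m - s) - g (be i m - s))).
Proof.
move=> dG.
have d1 (a : R) : is_derive s 1 (fun s => G (a - s)) (- g (a - s)).
  have da : is_derive s 1 (fun s : R => a - s) (-1).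
    have := is_deriveB (is_derive_cst a s 1) (is_derive_id s 1).
    by rewrite sub0r.
  have := @is_derive1_comp _ G (fun s : R => a - s) s _ _ (dG _) da.
  by rewrite mulrN1.
have d2 i (m : 'I_(M i)) : is_derive s 1 (fun s => G (be i m - s) - G (al i m - s))
    (g (al i m - s) - g (be i m - s)).
  apply: (@is_derive_eq _ _ _ _ _ _ _ _ (is_deriveB (d1 (be i m)) (d1 (al i m)))).
  ring.
have d3 i := is_derive_sum (d2 i).
have := is_derive_sum d3.
set f := (X in is_derive _ _ X _ -> _); set f' := (X in _ -> is_derive _ _ X _).
suff -> : f = f' by [].
by apply/funext => x; rewrite /f fct_sumE; apply: eq_bigr => i _; rewrite fct_sumE.
Qed.

Lemma pattern_increasing (R : realType) (N : int -> nat) (Q : nat) (G g : R -> R)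
    (nu : {measure set (measurableTypeR R) -> \bar R}) :
  (forall x : R, is_derive x 1 G (g x)) ->
  (forall (j : int) (s : R), j%:~R <= s <= j%:~R + 1 ->
    0 < \sum_(i < Q.+2) \sum_(m < N (j + i%:Z))
       (g ((j + i%:Z)%:~R + m%:R / (N (j + i%:Z))%:R - s) -
        g ((j + i%:Z)%:~R + (m%:R + density R (j + i%:Z)) / (N (j + i%:Z))%:R - s))) ->
  (forall a b : R, a <= b -> nu `]a, b]%classic = (G b - G a)%:E) ->
  nu (~` `]0, Q%:R]%classic) = 0%E ->
  forall s s' : R, s < s' ->
  (nu [set t | pattern N (t + s)%R] < nu [set t | pattern N (t + s')%R])%E.
Proof.
move=> dG pos nuE nu0.
have cell (j : int) (s s' : R) : j%:~R <= s -> s < s' -> s' <= j%:~R + 1 ->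
    (nu [set t | pattern N (t + s)%R] < nu [set t | pattern N (t + s')%R])%E.
  move=> js ss sj.
  rewrite !(measure_pattern N nuE nu0 (j := j)); [|by apply/andP; split; lra..].
  rewrite lte_fin.
  have df x := @is_derive_pattern R G g Q.+2 (fun i => N (j + i%:Z))
    (fun i m => (j + (i : 'I_Q.+2)%:Z)%:~R + m%:R / (N (j + i%:Z))%:R)
    (fun i m => (j + i%:Z)%:~R + (m%:R + density R (j + i%:Z)) / (N (j + i%:Z))%:R) x dG.
  have [|c cs] := MVT ss (fun x _ => df x).
    apply: derivable_within_continuous => x _.
    by case: (df x).
  move=> e; rewrite -subr_gt0 e mulr_gt0 ?subr_gt0// pos//.
  by move: cs; rewrite in_itv/= => /andP[? ?]; apply/andP; split; lra.
have steps n (j : int) (s s' : R) : j%:~R <= s -> s < s' -> s' <= j%:~R + n%:R ->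
    (nu [set t | pattern N (t + s)%R] < nu [set t | pattern N (t + s')%R])%E.
  elim: n j s s' => [|n IH] j s s' js ss sj;
    first by move: (lt_le_trans ss sj); rewrite addr0 ltNge js.
  have [s1|s1] := leP s' (j%:~R + 1); first exact: (cell j).
  have js1 : (j + 1)%:~R = j%:~R + 1 :> R by rewrite intrD.
  have sjn : s' <= (j + 1)%:~R + n%:R by rewrite js1 -addrA (addrC 1) natr1.
  have [s2|s2] := leP (j%:~R + 1) s.
    by apply: (IH (j + 1)) => //; rewrite js1.
  apply: (@lt_trans _ _ (nu [set t | pattern N (t + (j%:~R + 1))])).
    exact: (cell j).
  by apply: (IH (j + 1)) => //; rewrite js1.
move=> s s' ss.
have /andP[fl fh] := real_floor_itv (num_real s); rewrite intrD in fh.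
apply: (steps (Num.truncn (s' - (Num.floor s)%:~R)).+1 (Num.floor s)) => //.
by rewrite -lerBlDl ltW// truncnS_gt.
Qed.

(** * Lebesgue measure on the plane *)

Section plane.
Context {R : realType}.
Local Notation RR := (measurableTypeR R).
Local Notation L1 := (@lebesgue_measure R).

(** This is the measure whose completion is [lebesgue2]; it serves for Borel
    sets, on which Fubini's theorem is available. *)
Definition borel2 : set (RR * RR) -> \bar R := (L1 \x L1)%E.
HB.instance Definition _ := Measure.on borel2.

(** The translate of the measure agrees with it on half-open intervals. *)
Lemma lebesgue_translate (A : set RR) (b : R) : measurable A ->
  L1 [set t | A (t + b)] = L1 A.
Proof.
move=> mA; apply/esym.
have mf : measurable_fun setT ((fun t => t + b) : RR -> RR) by exact: measurable_funD.
pose f : {mfun RR >-> RR} := HB.pack ((fun t => t + b) : RR -> RR) (isMeasurableFun.Build _ _ _ _ _ mf).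
rewrite -[RHS]/(pushforward L1 f A).
apply: lebesgue_measure_unique mA => X /ocitvP[->|[[x y] /= xy ->]]; first by rewrite !measure0.
rewrite /pushforward /=.
have -> : (fun t => t + b) @^-1` `]x, y]%classic = `]x - b, y - b]%classic.
  by apply/seteqP; split => t /=; rewrite !in_itv/= ltrBlDr lerBrDr.
by rewrite !lebesgue_measure_itv/= !lte_fin xy ltrD2r xy -!EFinD; congr EFin; ring.
Qed.

Lemma borel2E_ysection (B : set (RR * RR)) : measurable B ->
  borel2 B = (\int[L1]_y L1 (ysection B y))%E.
Proof.
move=> mB; rewrite /borel2.
have := @product_measure_unique _ _ _ _ R L1 L1 (L1 \x^ L1)%E _ B mB.
by apply => A A' mA mA'; exact: product_measure2E.
Qed.

(** By Fubini, each horizontal section is merely translated. Both the passage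
    to lines of slope [a] and horizontal translations are of this form. *)
Lemma borel2_hshear (B : set (RR * RR)) (f : RR -> RR) : measurable B ->
  measurable_fun setT f -> 
  measurable [set p : RR * RR | B (p.1 + f p.2, p.2)] /\
  borel2 [set p : RR * RR | B (p.1 + f p.2, p.2)] = borel2 B.
Proof.
move=> mB mf.
have mg : measurable_fun setT ((fun p => (p.1 + f p.2, p.2)) : RR * RR -> RR * RR).
  apply: measurable_fun_pair => //; apply: measurable_funD => //.
  by apply: measurableT_comp.
have mB' : measurable [set p : RR * RR | B (p.1 + f p.2, p.2)].
  by rewrite -[X in measurable X]setTI; exact: mg.
split => //; rewrite !borel2E_ysection//; apply: eq_integral => y _.
rewrite -[RHS](lebesgue_translate (f y)); last exact: measurable_ysection.
congr (L1 _); apply/seteqP; split => t; by rewrite /ysection/= !inE.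
Qed.

Lemma borel2_vtranslate (B : set (RR * RR)) (c : R) : measurable B ->
  measurable [set p : RR * RR | B (p.1, p.2 + c)] /\
  borel2 [set p : RR * RR | B (p.1, p.2 + c)] = borel2 B.
Proof.
move=> mB.
have mg : measurable_fun setT ((fun p => (p.1, p.2 + c)) : RR * RR -> RR * RR).
  by apply: measurable_fun_pair => //; apply: measurable_funD.
have mB' : measurable [set p : RR * RR | B (p.1, p.2 + c)].
  by rewrite -[X in measurable X]setTI; exact: mg.
split => //; rewrite /borel2/product_measure1; apply: eq_integral => y _ /=.
rewrite -[RHS](lebesgue_translate c); last exact: measurable_xsection.
congr (L1 _); apply/seteqP; split => t; by rewrite /xsection/= !inE.
Qed.

Lemma borel2_translate (B : set (RR * RR)) (z : R * R) : measurable B ->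
  measurable [set p : RR * RR | B (p + z)] /\ borel2 [set p : RR * RR | B (p + z)] = borel2 B.
Proof.
move=> mB.
have [m1 e1] := borel2_vtranslate z.2 mB.
have mc : measurable_fun setT (cst z.1 : RR -> RR) by [].
by have [] := borel2_hshear m1 mc; rewrite /= e1.
Qed.

Lemma lebesgue2_borel (B : set (R * R)) : measurable (B : set (RR * RR)) ->
  lebesgue2 B = borel2 B.
Proof. by move=> mB; rewrite /lebesgue2 /completed_measure_extension measurable_mu_extE. Qed.

(** An open set is a union of squares with rational centre and radius. *)
Lemma open_borel2 (U : set (R * R)) : open U -> measurable (U : set (RR * RR)).
Proof.
move=> oU.
pose r (q : rat * rat * rat) : set (RR * RR) :=
  ball (ratr q.1.1 : R) (ratr q.2) `*` ball (ratr q.1.2 : R) (ratr q.2).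
suff -> : U = \bigcup_(q in [set q | r q `<=` U]) r q.
  rewrite bigcup_mkcond; apply: countable_bigcupT_measurable; first exact: countableP.
  move=> q; case: ifP => // _; apply: measurableX; exact: measurable_ball.
apply/seteqP; split; last by move=> p [q qU /qU].
move=> p Up; have : nbhs p U by exact: open_nbhs_nbhs.
case=> -[/= A B] [/nbhs_ballP[e1 /= e10 A1] /nbhs_ballP[e2 /= e20 B2]] ABU.
pose e := Num.min e1 e2.
have e0 : 0 < e by rewrite lt_min e10.
have [d] := @rat_in_itvoo R 0 (e / 2) ltac:(by rewrite divr_gt0).
rewrite in_itv/= => /andP[d0 de].
have [ee1 ee2] : e <= e1 /\ e <= e2 by rewrite !ge_min !lexx orbT.
have [x] := @rat_in_itvoo R (p.1 - ratr d) p.1 ltac:(by rewrite ltrBlDr ltrDl).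
rewrite in_itv/= => /andP[x1 x2].
have [y] := @rat_in_itvoo R (p.2 - ratr d) p.2 ltac:(by rewrite ltrBlDr ltrDl).
rewrite in_itv/= => /andP[y1 y2].
exists (x, y, d) => /=.
  move=> [s t]; rewrite /r/= /ball/= => -[sx ty]; apply: ABU; split => /=.
    by apply: A1; rewrite /ball/=; move: sx; rewrite !ltr_norml => /andP[? ?];
      apply/andP; split; lra.
  by apply: B2; rewrite /ball/=; move: ty; rewrite !ltr_norml => /andP[? ?];
    apply/andP; split; lra.
split => /=; rewrite /ball/= distrC ger0_norm; lra.
Qed.
End plane.

(** * Length, projections and lines *)

Local Notation edist := (@Defs.edist _).

Section hausdorff.
Context {R : realType}.
Local Notation RR := (measurableTypeR R).
Local Notation L1 := (@lebesgue_measure R).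

Lemma edist_ge1 (p q : R * R) : `|p.1 - q.1| <= edist p q.
Proof. by rewrite /edist -sqrtr_sqr ler_wsqrtr// lerDl sqr_ge0. Qed.

Lemma edist_ge2 (p q : R * R) : `|p.2 - q.2| <= edist p q.
Proof. by rewrite /edist -sqrtr_sqr ler_wsqrtr// lerDr sqr_ge0. Qed.

(** The constant exceeds the length by 1, so that for each delta the infimum
    is reached up to that margin. *)
Lemma hausdorff1_cover (A : set (R * R)) : (hausdorff1 A < +oo)%E ->
  exists2 C : R, 0 <= C & forall delta : R, 0 < delta ->
    exists (U : nat -> set (R * R)) (d : nat -> R),
    [/\ forall k, 0 <= d k <= delta,
        forall k p q, U k p -> U k q -> edist p q <= d k,
        A `<=` \bigcup_k U k & (\sum_(0 <= k <oo) (d k)%:E <= C%:E)%E].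
Proof.
move=> Hoo.
have pre0 (d : R) : (0 <= hausdorff1_pre d A)%E.
  apply: le_ereal_inf_tmp => _ [U _ <-]; apply: nneseries_ge0 => k _ _.
  by rewrite /ediam le_max lexx.
have preH (d : R) : 0 < d -> (hausdorff1_pre d A <= hausdorff1 A)%E.
  by move=> d0; apply: ereal_sup_ubound; exists d.
have H0 : (0 <= hausdorff1 A)%E by apply: le_trans (pre0 1) (preH 1 _).
exists (fine (hausdorff1 A) + 1); first by rewrite addr_ge0// fine_ge0.
move=> delta d0.
have : (hausdorff1_pre delta A < (fine (hausdorff1 A) + 1)%:E)%E.
  apply: le_lt_trans (preH _ d0) _.
  by rewrite EFinD fineK ?ge0_fin_numE// lteDl ?ge0_fin_numE// lte01.
move=> /ereal_inf_lt[_ [U [Ud AU] <-]] sU.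
have fU k : ediam (U k) \is a fin_num.
  rewrite ge0_fin_numE ?(le_lt_trans (Ud k))// ?ltry//.
  by rewrite /ediam le_max lexx.
exists U, (fun k => fine (ediam (U k))); split => //.
- move=> k; rewrite fine_ge0 ?le_max ?lexx//=.
  by rewrite -lee_fin fineK.
- move=> k p q Up Uq; rewrite -lee_fin fineK// /ediam le_max; apply/orP; right.
  by apply: ereal_sup_ubound; exists (p, q).
- apply/ltW; apply: le_lt_trans sU; apply: lee_nneseries => k;
    first by rewrite lee_fin fine_ge0// le_max lexx.
  by rewrite fineK.
Qed.

(** When its members have diameter less than [r], a set of the cover meets
    at most one of the pieces, and its projection lies in an interval of length
    twice its diameter. Hence the projections of all the pieces together are
    charged at most twice the sum of the diameters. *)
Lemma separated_projections (A : set (R * R)) : (hausdorff1 A < +oo)%E ->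
  exists2 C : R, 0 <= C & forall (n : nat) (P : 'I_n -> set (R * R)) (Y : 'I_n -> set RR) (r : R),
   0 < r -> (forall i, P i `<=` A) -> (forall i, measurable (Y i)) ->
   (forall i, Y i `<=` snd @` P i) ->
   (forall i j p q, i != j -> P i p -> P j q -> r <= edist p q) ->
   (\sum_(i < n) L1 (Y i) <= C%:E)%E.
Proof.
move=> /hausdorff1_cover[C C0 cov]; exists (2 * C); first by rewrite mulr_ge0.
move=> n P Y r r0 PA mY YP sep.
have r20 : 0 < r / 2 by rewrite divr_gt0.
have [U [d [dr Ud AU dC]]] := cov _ r20.
pose meets k i := exists p, U k p /\ P i p.
(* height of some point of U k; a default value when U k is empty, in which
   case U k meets no piece *)
pose c k : R := (get (snd @` U k) : R).
pose D k i : set RR := if `[< meets k i >] then `[c k - d k, c k + d k]%classic else set0.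
have mD k i : measurable (D k i) by rewrite /D; case: ifP => // _; exact: measurable_itv.
have YD i : Y i `<=` \bigcup_k D k i.
  move=> y /YP[p Pp <-]; have [k _ Up] := AU p (PA i p Pp).
  exists k => //; rewrite /D; case: asboolP => [_|[]]; last by exists p.
  have : (snd @` U k) (c k) by apply: (@getI _ _ p.2); exists p.
  move=> [q Uq qc]; have := le_trans (edist_ge2 p q) (Ud k p q Up Uq).
  rewrite qc ler_norml /= in_itv/= => /andP[? ?]; apply/andP; split; lra.
have LD k i : (L1 (D k i) <= (2 * d k)%:E)%E.
  rewrite /D; case: ifP => _; last by rewrite measure0 lee_fin mulr_ge0//; case/andP: (dr k).
  rewrite lebesgue_measure_itv/= lte_fin; case: ifP => _.
    by rewrite -EFinD lee_fin; lra.
  by rewrite lee_fin mulr_ge0//; case/andP: (dr k).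
apply: (@le_trans _ _ (\sum_(i < n) \sum_(0 <= k <oo) L1 (D k i))%E).
  by apply: lee_sum => i _; apply: measure_sigma_subadditive.
rewrite -nneseries_sum//.
apply: (@le_trans _ _ (\sum_(0 <= k <oo) 2%:E * (d k)%:E)%E); last first.
  rewrite nneseriesZl; last by move=> k _; rewrite lee_fin; case/andP: (dr k).
  by rewrite EFinM lee_pmul2l.
apply: lee_nneseries => k; first by rewrite sume_ge0.
rewrite -EFinM.
have [[i0 mi0]|nm] := pselect (exists i, meets k i).
  rewrite (bigD1 i0)//= big1 ?adde0//.
  move=> i ii0; rewrite /D; case: asboolP => [mi|_]; last by rewrite measure0.
  have [p [Up Pp]] := mi; have [q [Uq Pq]] := mi0.
  have := sep _ _ _ _ ii0 Pp Pq; have := Ud _ _ _ Up Uq.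
  have /andP[_] := dr k; move=> h1 h2 h3; exfalso; lra.
rewrite big1; first by rewrite lee_fin mulr_ge0//; case/andP: (dr k).
move=> i _; rewrite /D; case: asboolP => [mi|_]; last by rewrite measure0.
by case: nm; exists i.
Qed.

End hausdorff.

Section slopes.
Context {R : realType}.
Local Notation RR := (measurableTypeR R).
Local Notation L1 := (@lebesgue_measure R).

(** Points of the line x + a * y = t are parametrized by y, so that the
    parameter is the projection to the second axis whatever the slope. *)
Definition line_section (a : R) (A : set (R * R)) (t : R) : set RR :=
  [set y | A (t - a * y, y)].

Lemma measurable_line_section (a : R) (A : set (RR * RR)) (t : R) :
  measurable A -> measurable (line_section a A t).
Proof.
move=> mA.
have mf : measurable_fun setT ((fun y => (t - a * y, y)) : RR -> RR * RR).
  apply: measurable_fun_pair => //; apply: measurable_funB => //.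
by rewrite -[X in measurable X]setTI; exact: mf.
Qed.

Lemma pos_lower_bound (I : finType) (f : I -> R) : (forall i, 0 < f i) ->
  exists2 r, 0 < r & forall i, r <= f i.
Proof.
move=> f0; exists (\big[Num.min/1]_i f i); first by apply: lt_bigmin.
by move=> i; exact: bigmin_le.
Qed.

(** Two lines of different slopes have one common point. Deleting from each of
    m heavy sections short intervals around its points on the other lines leaves
    separated sets, of total measure at least m * e - 1 and at most [C]; so m is
    bounded. *)
Lemma heavy_slopes_finite (A : set (RR * RR)) (e : R) : (hausdorff1 A < +oo)%E ->
  measurable A -> 0 < e ->
  finite_set [set a : R | 0 <= a <= 1 /\ exists t, (e%:E <= L1 (line_section a A t))%E].
Proof.
move=> /separated_projections[C C0 sep] mA e0.
apply: contrapT => /infiniteP/ppcard_leP[f].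
have fP i : 0 <= f i <= 1 /\ exists t, (e%:E <= L1 (line_section (f i) A t))%E.
  exact: (@funS _ _ setT _ f i I).
have finj i j : f i = f j -> i = j by move=> h; apply: (@inj _ _ _ f) => //; rewrite inE.
have /choice[t tP] (i : nat) : exists t, (e%:E <= L1 (line_section (f i) A t))%E.
  by case: (fP i).
pose m := (Num.truncn ((C + 1) / e)).+1.
have mC : C + 1 < e * m%:R.
  by rewrite mulrC -ltr_pdivrMr// truncnS_gt.
have m0 : 0 < m%:R :> R by [].
(* chosen so that the m * m deleted intervals have total length 1 *)
pose eta := (2 * m%:R ^+ 2)^-1 : R.
have eta0 : 0 < eta by rewrite invr_gt0 mulr_gt0// exprn_gt0.
pose y i j := (t i - t j) / (f i - f j).
pose H (i j : nat) : set RR := if j == i then set0 else `](y i j - eta), (y i j + eta)[%classic.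
have mH i j : measurable (H i j) by rewrite /H; case: ifP => // _; exact: measurable_itv.
pose X i : set RR := \big[setU/set0]_(j < m) H i j.
have mX i : measurable (X i) by apply: bigsetU_measurable.
pose S (i : 'I_m) := line_section (f i) A (t i).
have mS i : measurable (S i) by exact: measurable_line_section.
pose Y i : set RR := S i `\` X i.
have mY i : measurable (Y i) by exact: measurableD.
pose P (i : 'I_m) : set (R * R) := [set p | A p /\ p.1 = t i - f i * p.2 /\ Y i p.2].
have [r r0 rP] : exists2 r : R, 0 < r & forall ij : 'I_m * 'I_m,
    r <= if ij.1 == ij.2 then 1 else `|f ij.1 - f ij.2| * eta / 2.
  apply: pos_lower_bound => -[i j]/=; case: eqVneq => // ij.
  rewrite divr_gt0// mulr_gt0// normr_gt0 subr_eq0.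
  by apply: contra_neq ij => /finj /val_inj.
have LH i j : (L1 (H i j) <= (2 * eta)%:E)%E.
  rewrite /H; case: ifP => _; first by rewrite measure0 lee_fin mulr_ge0// ltW.
  by rewrite lebesgue_measure_itv/= lte_fin ltrD2l gtrN// -EFinD lee_fin; lra.
have LX i : (L1 (X i) <= (m%:R * (2 * eta))%:E)%E.
  apply: le_trans (@Boole_inequality _ _ _ L1 (H i) m (fun j _ => mH i j)) _.
  apply: (@le_trans _ _ (\sum_(j < m) (2 * eta)%:E)%E).
    by apply: lee_sum => j _; exact: LH.
  by rewrite sumEFin sumr_const card_ord lee_fin [m%:R * _]mulr_natl.
have LY (i : 'I_m) : (e%:E <= L1 (Y i) + (m%:R * (2 * eta))%:E)%E.
  apply: (le_trans (tP i)); rewrite -/(S i) -(setUIDK (S i) (X i)).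
  apply: le_trans (@measureU2 _ _ _ L1 _ _ (measurableI _ _ (mS i) (mX i)) (mY i)) _.
  rewrite addeC leeD2l//; apply: le_trans (LX i).
  by apply: le_measure; rewrite ?inE//; exact: measurableI.
have := sep m P Y r r0.
have PA i : P i `<=` A by move=> p [].
have YP i : Y i `<=` snd @` P i.
  by move=> u Yu; exists (t i - f i * u, u) => //; split => //; case: Yu.
move=> /(_ PA mY YP) sepY.
have {}sepY : (\sum_(i < m) L1 (Y i) <= C%:E)%E.
  apply: sepY => i j p q ij [_ [p1 Yp]] [_ [q1 Yq]].
  have nij : f i - f j != 0 by rewrite subr_eq0; apply: contra_neq ij => /finj /val_inj.
  have := rP (i, j); rewrite /= (negbTE ij) => rij.
  have [small|] := ltP (`|p.2 - q.2|) r; last by move/le_trans; apply; exact: edist_ge2.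
  apply: le_trans (edist_ge1 p q).
  (* p is far from the crossing point of its line with that of q, so the lines
   are far apart at the height of p *)
  have far : eta <= `|p.2 - y i j|.
    rewrite leNgt; apply/negP => near; case: Yp => _; apply.
    rewrite /X -bigcup_mkord; exists (j : nat); first exact: ltn_ord.
    rewrite /H eq_sym -val_eqE/= in ij *; rewrite (negbTE ij) /= in_itv/=.
    by move: near; rewrite ltr_norml => /andP[? ?]; apply/andP; split; lra.
  have pq : p.1 - q.1 = - ((f i - f j) * (p.2 - y i j)) + f j * (q.2 - p.2).
    by rewrite p1 q1 /y; field.
  have fj : `|f j * (q.2 - p.2)| <= r.
    have [/andP[fj0 fj1] _] := fP j.
    rewrite normrM ger0_norm// distrC (le_trans _ (ltW small))// ler_piMl//.
  have big : `|f i - f j| * eta <= `|(f i - f j) * (p.2 - y i j)|.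
    by rewrite normrM ler_wpM2l.
  have tri : `|(f i - f j) * (p.2 - y i j)| <= `|f j * (q.2 - p.2)| + `|p.1 - q.1|.
    have -> : (f i - f j) * (p.2 - y i j) = f j * (q.2 - p.2) - (p.1 - q.1).
      by rewrite pq; ring.
    exact: ler_normB.
  lra.
have : (\sum_(i < m) e%:E <= \sum_(i < m) (L1 (Y i) + (m%:R * (2 * eta))%:E))%E.
  by apply: lee_sum => i _; exact: LY.
rewrite big_split/= !sumEFin !sumr_const card_ord leNgt => /negP; apply.
apply: le_lt_trans (leeD2r _ sepY) _.
rewrite -EFinD lte_fin -(mulr_natr e m) -(mulr_natr (m%:R * (2 * eta)) m); apply: le_lt_trans mC.
rewrite lerD2l /eta.
have -> : m%:R * (2 * (2 * m%:R ^+ 2)^-1) * m%:R = 1 :> R by field; rewrite gt_eqF.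
by [].
Qed.

Lemma unit_interval_avoids (D : set R) : countable D ->
  exists2 a, 0 <= a <= 1 & ~ D a.
Proof.
move=> cD; apply: contrapT => h.
have : (L1 `[0%R, 1%R]%classic <= L1 D)%E.
  apply: le_measure; rewrite ?inE;
    [exact: measurable_itv|exact: countable_measurable|].
  move=> a /=; rewrite in_itv/= => a01; apply: contrapT => nD; apply: h.
  by exists a.
rewrite (countable_lebesgue_measure0 cD) lebesgue_measure_itv/= lte_fin ltr01.
by rewrite -EFinB subr0 lee_fin ler10.
Qed.

Lemma two_null_slopes (A : set (RR * RR)) : (hausdorff1 A < +oo)%E -> measurable A ->
  exists a b : R, [/\ 0 <= a <= 1, 0 <= b <= 1, a != b,
    forall t, L1 (line_section a A t) = 0%E & forall t, L1 (line_section b A t) = 0%E].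
Proof.
move=> Hoo mA.
pose bad : set R := \bigcup_n [set a : R | 0 <= a <= 1 /\
   exists t, ((n.+1%:R^-1)%:E <= L1 (line_section a A t))%E].
have cbad : countable bad.
  apply: bigcup_countable => // n _; apply: finite_set_countable.
  by apply: heavy_slopes_finite.
have good a : 0 <= a <= 1 -> ~ bad a -> forall t, L1 (line_section a A t) = 0%E.
  move=> a01 nbad t; apply/eqP; rewrite -measure_le0 leNgt; apply/negP => pos.
  apply: nbad.
  have [n nP] : exists n, ((n.+1%:R^-1)%:E <= L1 (line_section a A t))%E.
    have [xoo|xfin] := eqVneq (L1 (line_section a A t)) +oo%E.
      by exists 0%N; rewrite xoo leey.
    have xf : L1 (line_section a A t) \is a fin_num.
      by rewrite ge0_fin_numE// lt_neqAle xfin leey.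
    have r0 : 0 < fine (L1 (line_section a A t)) by rewrite fine_gt0// pos ltey_eq xf.
    exists (Num.truncn (fine (L1 (line_section a A t)))^-1).
    rewrite -[leRHS]fineK// lee_fin invf_ple ?posrE//.
    by rewrite ltW// truncnS_gt.
  by exists n => //; split => //; exists t.
have [a a01 na] := unit_interval_avoids cbad.
have cb1 : countable (bad `|` [set a]).
  by rewrite -bigcup2E; apply: bigcup_countable => // -[|[|n]] _ //=;
    exact: finite_set_countable.
have [b b01 nb] := unit_interval_avoids cb1.
exists a, b; split => //; [|exact: good|].
  by apply/eqP => ab; apply: nb; right.
by apply: good => // ?; apply: nb; left.
Qed.
End slopes.

(** * Continuous functions of bounded variation *)

Lemma norm_four_points (R : realType) (x y z w e : R) :
  `|x - y| <= e -> `|z - w| <= e -> `|y - w| <= `|x - z| + 2 * e.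
Proof.
move=> xy zw; have -> : y - w = (x - z) - ((x - y) - (z - w)) by ring.
apply: le_trans (ler_normB _ _) _; rewrite lerD2l.
by apply: le_trans (ler_normB _ _) _; lra.
Qed.

(** Heine's theorem, in the form of a modulus. *)
Lemma uniform_continuity_itv (R : realType) (f : R -> R) (b c : R) :
  {within `[b, c], continuous f} -> forall e : R, 0 < e -> exists2 d : R, 0 < d &
   forall x y, b <= x <= c -> b <= y <= c -> `|y - x| <= d -> `|f y - f x| <= e.
Proof.
move=> /subspace_continuousP cf e e0.
have cpt := @segment_compact R b c.
have /compact_near_coveringP/(_ R (0^'+)) := cpt.
move=> /(_ (fun d x => forall y, b <= x <= c -> b <= y <= c -> `|y - x| <= d -> `|f y - f x| <= e)).
case.
- move=> x xbc; have /cvgrPdist_le/(_ (e / 2)) := cf x xbc.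
  case; first by rewrite divr_gt0.
  move=> d /= d0 dP.
  near=> x' d' => /= y bx' by_ yx'.
  have d'd : d' < d / 2 by near: d'; apply: nbhs_right_lt; rewrite divr_gt0.
  have x'd : `|x - x'| < d / 2 by near: x'; exists (d / 2) => //=; rewrite divr_gt0.
  have h1 : `|f x - f x'| <= e / 2.
    apply: dP; rewrite /= ?in_itv//=; lra.
  have h2 : `|f x - f y| <= e / 2.
    apply: dP; rewrite /= ?in_itv//=.
    have -> : x - y = (x - x') - (y - x') by ring.
    by apply: le_lt_trans (ler_normB _ _) _; lra.
  have -> : f y - f x' = (f x - f x') - (f x - f y) by ring.
  by apply: le_trans (ler_normB _ _) _; lra.
- move=> d d0 dP; exists (d / 2); first by rewrite divr_gt0.
  have d2 : (0 : R) < d / 2 by rewrite divr_gt0.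
  have db : `|0 - d / 2| < d by rewrite sub0r normrN gtr0_norm//; lra.
  move=> x y bx by_; apply: (dP (d / 2) db d2 x) => //=.
Unshelve. all: by end_near. Qed.

(** [V] is the total variation from [b]; both [V] and V - f are nondecreasing. *)
Lemma jordan_decomposition (R : realType) (f : R -> R) (b c : R) : b < c ->
  {within `[b, c], continuous f} -> bounded_variation b c f ->
  exists V : R -> R,
   [/\ {within `[b, c], continuous V},
       forall x y, b <= x -> x <= y -> y <= c -> V x <= V y &
       forall x y, b <= x -> x <= y -> y <= c -> f y - f x <= V y - V x].
Proof.
move=> bc cf bv.
have key x y : b <= x -> x <= y -> y <= c ->
    `|f y - f x| <= fine (total_variation b y f) - fine (total_variation b x f).
  move=> bx xy yc.
  have fx : total_variation b x f \is a fin_num.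
    apply/bounded_variationP => //; apply: bounded_variationl bv => //.
    exact: le_trans yc.
  have fxy : total_variation x y f \is a fin_num.
    apply/bounded_variationP => //.
    apply: (@bounded_variationl _ x y c) => //.
    by apply: bounded_variationr bv => //; exact: le_trans yc.
  rewrite (total_variationD f bx xy) fineD// addrAC subrr add0r.
  by rewrite -lee_fin fineK// total_variation_ge.
exists (fun x => fine (total_variation b x f)); split.
- exact: total_variation_continuous.
- by move=> x y bx xy yc; rewrite -subr_ge0; apply: le_trans (key x y bx xy yc).
- by move=> x y bx xy yc; apply: le_trans (key x y bx xy yc); exact: ler_norm.
Qed.

Section scaled.
Context {R : realType}.
Variables (g : R -> R) (K eta : R) (m : nat).
Hypothesis eta0 : 0 < eta.
Hypothesis KE : K = eta * m%:R.
Hypothesis m0 : (0 < m)%N.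
Hypothesis cg : continuous g.
Hypothesis bvg : bounded_variation (- K) K g.
Hypothesis g0 : forall t, K <= `|t| -> g t = 0.

Let Q := (2 * m)%N.
Let QE : Q%:R = 2 * m%:R :> R. Proof. by rewrite natrM. Qed.

(** The change of variable x |-> eta * (x - m) carries [0, 2 * m] onto [- K, K],
    and the function is extended by constants outside. The index selects V or
    V - g, where V is the variation of g. *)
Lemma scaled_decomposition : exists phi : bool -> R -> R,
  [/\ forall i, {homo phi i : x y / x <= y},
      forall i x, phi i x = phi i (clamp 0 Q%:R x),
      forall e : R, 0 < e -> exists2 d : R, 0 < d & forall i (x y : R),
        x <= y -> y <= x + d -> phi i y - phi i x <= e &
      forall x, eta * g (eta * (x - m%:R)) = phi true x - phi false x].
Proof.
have mR : 0 < m%:R :> R by rewrite ltr0n.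
have K0 : 0 < K by rewrite KE mulr_gt0.
have KK : - K < K by lra.
have cgK : {within `[- K, K], continuous g} by exact: continuous_subspaceT.
have [V [cV V1 V2]] := jordan_decomposition KK cgK bvg.
have Q0 : 0 <= Q%:R :> R by [].
pose w x := eta * (clamp 0 Q%:R x - m%:R).
have wK x : - K <= w x <= K.
  have h2 := clamp_ge 0 Q%:R x; have := clamp_le x Q0; rewrite [leRHS]QE => h1.
  by rewrite KE /w -mulrN !ler_pM2l//; apply/andP; split; lra.
have wm x y : x <= y -> w x <= w y.
  by move=> xy; rewrite /w ler_pM2l// lerD2r clamp_homo.
have wl x y : x <= y -> w y - w x <= eta * (y - x).
  move=> xy; have := @clamp_lip _ 0 Q%:R x y xy.
  rewrite -(ler_pM2l eta0) /w; lra.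
have wc x : w (clamp 0 Q%:R x) = w x.
  by rewrite /w clamp_id// ?clamp_ge ?clamp_le.
exists (fun i x => eta * (if i then V (w x) else V (w x) - g (w x))); split.
- move=> i x y xy; rewrite ler_pM2l//.
  have /andP[x1 x2] := wK x; have /andP[y1 y2] := wK y.
  have h1 := V1 _ _ x1 (wm _ _ xy) y2; have h2 := V2 _ _ x1 (wm _ _ xy) y2.
  case: i => //; lra.
- by move=> i x; rewrite wc.
- move=> e e0.
  have e1 : 0 < e / (2 * eta) by rewrite divr_gt0// mulr_gt0.
  have [d1 d10 h1] := uniform_continuity_itv cV e1.
  have [d2 d20 h2] := uniform_continuity_itv cgK e1.
  exists (Num.min d1 d2 / eta); first by rewrite divr_gt0// lt_min d10.
  move=> i x y xy yx.
  have dw : `|w y - w x| <= Num.min d1 d2.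
    rewrite ger0_norm; last by rewrite subr_ge0 wm.
    apply: le_trans (wl _ _ xy) _; rewrite mulrC -ler_pdivlMr//; lra.
  rewrite le_min in dw; move: dw => /andP[dw1 dw2].
  have k1 := h1 _ _ (wK x) (wK y) dw1; have k2 := h2 _ _ (wK x) (wK y) dw2.
  rewrite -mulrBr mulrC -ler_pdivlMr//.
  have eE : e / eta = 2 * (e / (2 * eta)) by field; rewrite gt_eqF.
  move: k1 k2; rewrite eE; set e' := e / _; rewrite !ler_norml => /andP[? ?] /andP[? ?].
  case: i; lra.
- move=> x; rewrite -mulrBr subKr; congr (eta * _).
  have [x0|x0] := leP x 0.
    rewrite /w clamp_low// !g0//.
      by rewrite sub0r mulrN normrN KE ler_norm.
    rewrite KE -normrN -mulrN opprB (le_trans _ (ler_norm _))// ler_pM2l//; lra.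
  have [xQ|xQ] := leP Q%:R x.
    rewrite /w clamp_high// !g0//.
      by rewrite QE KE (le_trans _ (ler_norm _))// ler_pM2l//; lra.
    by rewrite KE (le_trans _ (ler_norm _))// ler_pM2l//; rewrite QE in xQ; lra.
  by rewrite /w clamp_id// ltW.
Qed.
End scaled.

(** * Lengths of parallel sections *)

Lemma closed_boundary (T : topologicalType) (A : set T) : closed (boundary A).
Proof.
rewrite /boundary setDE; apply: closedI; first exact: closed_closure.
by apply: open_closedC; exact: open_interior.
Qed.

Lemma strip_dist (R : realType) (t x z d e : R) : d < e ->
  t - d <= x + z <= t + d -> `|t - z - x| < e.
Proof. by move=> de /andP[? ?]; rewrite ltr_norml; apply/andP; split; lra. Qed.

Lemma half_close (R : realType) (u v : R) : `|u - v| <= v / 2 -> v / 2 <= u.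
Proof. by rewrite ler_norml => /andP[? ?]; lra. Qed.

Section line_sections.
Context {R : realType}.
Local Notation RR := (measurableTypeR R).
Local Notation L1 := (@lebesgue_measure R).
Variables (E : set (R * R)) (a M : R).
Hypothesis a01 : 0 <= a <= 1.
Hypothesis bE : forall p, boundary E p -> `|p.1| <= M /\ `|p.2| <= M.
Hypothesis iE : forall p, E° p -> `|p.1| <= M /\ `|p.2| <= M.
Hypothesis Hoo : (hausdorff1 (boundary E) < +oo)%E.
Hypothesis nullE : forall t, L1 (line_section a (boundary E) t) = 0%E.

Definition proj_strip (t t' : R) : set RR :=
  snd @` [set p | boundary E p /\ t <= p.1 + a * p.2 <= t'].

Lemma compact_strip (t t' : R) : compact [set p | boundary E p /\ t <= p.1 + a * p.2 <= t'].
Proof.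
apply: (subclosed_compact (B := `[- M, M]%classic `*` `[- M, M]%classic)).
- have cf : continuous (fun p : R * R => p.1 + a * p.2).
    move=> p; apply: cvgD; first exact: cvg_fst.
    by apply: cvgMr; exact: cvg_snd.
  have -> : [set p | boundary E p /\ t <= p.1 + a * p.2 <= t'] =
      boundary E `&` (fun p : R * R => p.1 + a * p.2) @^-1` `[t, t']%classic.
    by apply/seteqP; split => p /=; rewrite in_itv.
  apply: closedI; first exact: closed_boundary.
  apply: closed_comp => [p _|]; [exact: cf|exact: itv_closed].
- by apply: compact_setX; exact: segment_compact.
- by move=> p [/bE[h1 h2] _]; split; rewrite /= in_itv/= -ler_norml.
Qed.

Lemma measurable_proj_strip (t t' : R) : measurable (proj_strip t t').
Proof.
apply: compact_measurable; apply: continuous_compact; last exact: compact_strip.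
by apply: continuous_subspaceT => p; exact: cvg_snd.
Qed.

Lemma proj_strip_fin (t t' : R) : (L1 (proj_strip t t') < +oo)%E.
Proof.
apply: compact_finite_measure; apply: continuous_compact; last exact: compact_strip.
by apply: continuous_subspaceT => p; exact: cvg_snd.
Qed.

(** Otherwise the interior and the closure of [E] would have the same trace on
    the segment, which would be open and closed in it, hence everything or
    nothing since a segment is connected. *)
Lemma segment_crosses (x x' y : R) : x <= x' ->
  E° (x, y) <-> ~ E° (x', y) ->
  exists2 z, x <= z <= x' & boundary E (z, y).
Proof.
move=> xx' h; apply: contrapT => nb.
have nb' z : x <= z <= x' -> ~ boundary E (z, y) by move=> zx bz; apply: nb; exists z.
have cf : continuous (fun z : R => (z, y)).
  by move=> z; apply: (@cvg_pair _ _ _ _ (nbhs z) (nbhs y)) => /=; [exact: cvg_id|exact: cvg_cst].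
have conn := @segment_connected R x x'.
pose I : set R := (fun z : R => (z, y)) @^-1` E°.
have oI : open I by apply: open_comp => [z _|]; [exact: cf|exact: open_interior].
pose K : set R := (fun z : R => (z, y)) @^-1` closure E.
have cK : closed K by apply: closed_comp => [z _|]; [exact: cf|exact: closed_closure].
have IK : `[x, x']%classic `&` I = `[x, x']%classic `&` K.
  apply/seteqP; split => z [zx hz]; split => //.
    by apply: subset_closure; exact: interior_subset hz.
  apply: contrapT => nI; apply: (nb' z); last by split.
  by move: zx; rewrite /= in_itv.
have key : (`[x, x']%classic `&` I) !=set0 -> `[x, x']%classic `&` I = `[x, x']%classic.
  move=> ne; apply: (conn _ ne); first by exists I.
  by exists K.
have Ix : I x <-> E° (x, y) by [].
have [Ex|nEx] := pselect (E° (x, y)).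
  have /seteqP[_ sub] : `[x, x']%classic `&` I = `[x, x']%classic.
    by apply: key; exists x; split => //; rewrite /= in_itv/= lexx xx'.
  have [|_ Ex'] := sub x'; first by rewrite /= in_itv/= lexx xx'.
  by case: h => + _ => /(_ Ex).
have Ex' : E° (x', y) by apply: contrapT => n; apply: nEx; apply h.
have /seteqP[_ sub] : `[x, x']%classic `&` I = `[x, x']%classic.
  by apply: key; exists x'; split => //; rewrite /= in_itv/= lexx xx'.
have [|_ Ex] := sub x; first by rewrite /= in_itv/= lexx xx'.
exact: nEx.
Qed.

Definition section_length (t : R) : R := fine (L1 (line_section a E° t)).
Local Notation g := section_length.

Let mU : measurable (E° : set (RR * RR)).
Proof. by apply: open_borel2; exact: open_interior. Qed.

Let mS t : measurable (line_section a E° t).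
Proof. exact: measurable_line_section. Qed.

Lemma section_fin t : L1 (line_section a E° t) \is a fin_num.
Proof.
rewrite ge0_fin_numE//; apply: (@le_lt_trans _ _ (L1 `[- M, M]%classic)).
  apply: le_measure; rewrite ?inE; [exact: mS|exact: measurable_itv|].
  by move=> y /iE[_ /=]; rewrite in_itv/= ler_norml.
exact/compact_finite_measure/segment_compact.
Qed.

Lemma section_length_ge0 t : 0 <= g t.
Proof. exact: fine_ge0. Qed.

Lemma section_lengthE t : (g t)%:E = L1 (line_section a E° t).
Proof. by rewrite /g fineK// section_fin. Qed.

Lemma section_length0 t : 2 * M < `|t| -> g t = 0.
Proof.
move=> tM; rewrite /g; have -> : line_section a E° t = set0.
  apply/seteqP; split => // y /iE[/= h1 h2].
  have /andP[a0 a1] := a01.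
  have h3 : `|a * y| <= M.
    by rewrite normrM ger0_norm// (le_trans _ h2)// ler_piMl.
  have : `|t| <= `|t - a * y| + `|a * y| by rewrite -{1}(subrK (a * y) t) ler_normD.
  lra.
by rewrite measure0.
Qed.

(** A point of one section that is not in the other one is joined to the other
    line by a horizontal segment, which crosses the boundary. *)
Lemma section_length_diff t t' : t <= t' ->
  (`|g t' - g t|%:E <= L1 (proj_strip t t'))%E.
Proof.
move=> tt'.
have mP := measurable_proj_strip t t'.
have [r rE] : exists r : R, L1 (proj_strip t t') = r%:E.
  exists (fine (L1 (proj_strip t t'))).
  by rewrite fineK// ge0_fin_numE// proj_strip_fin.
have sub (u u' : R) : (u = t /\ u' = t') \/ (u = t' /\ u' = t) ->
    line_section a E° u `<=` line_section a E° u' `|` proj_strip t t'.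
  move=> uu y Uy; have [?|nU] := pselect (line_section a E° u' y); first by left.
  right; have [z zt bz] : exists2 z, t - a * y <= z <= t' - a * y & boundary E (z, y).
    apply: segment_crosses; first by rewrite lerD2r.
    case: uu => -[? ?]; subst u u'; first by split.
    by split => [h|nE']; exfalso; [exact: nU h|exact: nE' Uy].
  exists (z, y) => //; split => //=.
  by move: zt => /andP[? ?]; apply/andP; split; lra.
have le (u u' : R) : (u = t /\ u' = t') \/ (u = t' /\ u' = t) ->
    g u <= g u' + r.
  move=> uu; rewrite -lee_fin EFinD !section_lengthE -rE.
  apply: le_trans (@measureU2 _ _ _ L1 _ _ (mS u') mP).
  by apply: le_measure; rewrite ?inE; [exact: mS|exact: measurableU|exact: sub].
have h1 := le t t' (or_introl (conj erefl erefl)).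
have h2 := le t' t (or_intror (conj erefl erefl)).
by rewrite rE lee_fin ler_distl lerBlDr h1 h2.
Qed.

(** The strips around the line [t] shrink to the line, and as the boundary is
    closed their projections shrink to its section, which is null. *)
Lemma proj_strip_small t (e : R) : 0 < e ->
  exists2 d, 0 < d & (L1 (proj_strip (t - d) (t + d)) <= e%:E)%E.
Proof.
move=> e0.
pose F (n : nat) : set RR := proj_strip (t - n.+1%:R^-1) (t + n.+1%:R^-1).
have mF n : measurable (F n) by exact: measurable_proj_strip.
have capF : \bigcap_n F n `<=` line_section a (boundary E) t.
  move=> y Fy.
  have : closed (boundary E) by exact: closed_boundary.
  apply => V.
  case=> -[/= A B] [/nbhs_ballP[e1 /= e10 A1] B2] ABV.
  have [n ne] : exists n, (n.+1%:R^-1 : R) < e1.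
    exists (Num.truncn e1^-1); rewrite invf_plt ?posrE//; exact: truncnS_gt.
  have [[x y'] [bx /= xt] /= yE] := Fy n I; rewrite yE in bx xt.
  exists (x, y); split => //; apply: ABV; split => /=; last exact: nbhs_singleton.
  by apply: A1; rewrite /ball/=; apply: strip_dist ne xt.
have mcap : measurable (\bigcap_n F n) by exact: bigcapT_measurable.
have cap0 : L1 (\bigcap_n F n) = 0%E.
  apply/eqP; rewrite -measure_le0 -(nullE t); apply: le_measure; rewrite ?inE => //.
  apply: measurable_line_section.
  apply: (measurableD _ mU); rewrite -[X in measurable X]setCK; apply: measurableC.
  by apply: open_borel2; apply: closed_openC; exact: closed_closure.
have niF : nonincreasing_seq F.
  move=> m n mn; apply/subsetPset => y [p [bp pt] <-]; exists p => //; split => //.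
  have : n.+1%:R^-1 <= m.+1%:R^-1 :> R by rewrite lef_pV2 ?posrE// ler_nat.
  move: pt => /andP[p1 p2] nm; apply/andP; split.
    by apply: le_trans p1; rewrite lerD2l lerN2.
  by apply: le_trans p2 _; rewrite lerD2l.
have cvF : L1 \o F @ \oo --> 0%:E.
  rewrite -[0%:E]/(0%E) -cap0.
  exact: (@nonincreasing_cvg_mu _ _ _ L1 F (proj_strip_fin _ _) mF mcap niF).
have /fine_cvgP[fF /cvgrPdist_lt/(_ e e0)[n _ nP]] := cvF.
exists n.+1%:R^-1; first by [].
have := nP n (leqnn n); rewrite /= sub0r normrN ger0_norm ?fine_ge0// => /ltW h.
by rewrite -[leLHS]fineK ?lee_fin// ge0_fin_numE// proj_strip_fin.
Qed.

Lemma section_length_modulus t (e : R) : 0 < e ->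
  exists2 d, 0 < d & forall t', `|t' - t| <= d -> `|g t' - g t| <= e.
Proof.
move=> e0; have [d d0 dP] := proj_strip_small t e0.
exists d => // t'; rewrite ler_norml => /andP[h1 h2].
have sub u u' : t - d <= u -> u' <= t + d ->
    (L1 (proj_strip u u') <= e%:E)%E.
  move=> u1 u2; apply: le_trans dP; apply: le_measure; rewrite ?inE.
  - exact: measurable_proj_strip.
  - exact: measurable_proj_strip.
  move=> y [p [bp /andP[p1 p2]] <-]; exists p => //; split => //.
  by rewrite (le_trans u1 p1) (le_trans p2 u2).
rewrite -lee_fin; have [tt'|t't] := leP t t'.
  by apply: le_trans (section_length_diff tt') _; apply: sub; lra.
rewrite distrC; apply: le_trans (section_length_diff (ltW t't)) _.
by apply: sub; lra.
Qed.

Lemma section_length_continuous : continuous g.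
Proof.
move=> t; apply/cvgrPdist_le => e e0.
have [d d0 dP] := section_length_modulus t e0.
by near=> t'; rewrite distrC; apply: dP; rewrite distrC; near: t'; exact: cvgr_dist_le.
Unshelve. all: by end_near. Qed.

(** Shrinking the strips between consecutive lines by [r] on both sides makes
    them separated, and the continuity of [g] makes the loss negligible. *)
Lemma section_length_variation : exists C : R, forall n (t : nat -> R),
  (forall i, (i < n)%N -> t i < t i.+1) ->
  \sum_(i < n) `|g (t i.+1) - g (t i)| <= C.
Proof.
have [C C0 sep] := separated_projections Hoo.
exists C => n t tS; apply/ler_addgt0Pr => e e0.
pose e' := e / (2 * n.+1%:R).
have e'0 : 0 < e' by rewrite divr_gt0// mulr_gt0.
have /choice[d dP] (i : 'I_n.+1) : exists d, 0 < d /\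
    forall t', `|t' - t i| <= d -> `|g t' - g (t i)| <= e'.
  by have [d ? ?] := section_length_modulus (t i) e'0; exists d.
have [d1 d10 d1P] : exists2 r : R, 0 < r & forall i, r <= d i.
  by apply: pos_lower_bound => i; case: (dP i).
have [d2 d20 d2P] : exists2 r : R, 0 < r & forall i : 'I_n, r <= (t i.+1 - t i) / 2.
  by apply: pos_lower_bound => i; rewrite divr_gt0// subr_gt0 tS.
(* within r of each point g varies by at most e', and shrunk strips remain
   nonempty *)
pose r := Num.min d1 d2.
have r0 : 0 < r by rewrite lt_min d10.
have rd (i : 'I_n.+1) : r <= d i by rewrite ge_min d1P.
have rt (i : 'I_n) : r <= (t i.+1 - t i) / 2 by rewrite ge_min d2P orbT.
have tmono (i j : nat) : (i <= j)%N -> (j <= n)%N -> t i <= t j.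
  elim: j => [|j IH]; first by rewrite leqn0 => /eqP ->.
  rewrite leq_eqVlt => /predU1P[->//|]; rewrite ltnS => ij jn.
  by apply: le_trans (IH ij (ltnW jn)) (ltW (tS _ jn)).
pose P (i : 'I_n) : set (R * R) := [set p | boundary E p /\ t i + r <= p.1 + a * p.2 <= t i.+1 - r].
have sepP (i j : 'I_n) p q : (i < j)%N -> P i p -> P j q -> r <= edist p q.
  move=> ij [_ /andP[_ p1]] [_ /andP[q1 _]].
  have tij : t i.+1 <= t j by apply: tmono => //; exact: ltnW.
  have := edist_ge1 p q; have := edist_ge2 p q; set D := edist p q.
  rewrite !ler_norml => /andP[h1 h2] /andP[h3 h4].
  have /andP[a0 a1] := a01.
  have D0 : 0 <= D by rewrite /D sqrtr_ge0.
  have : a * (q.2 - p.2) <= 1 * D.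
    apply: (@le_trans _ _ (a * D)); first by rewrite ler_wpM2l//; lra.
    by rewrite ler_wpM2r.
  rewrite mulrBr; lra.
have edistC (p q : R * R) : edist p q = edist q p.
  by rewrite /edist; congr Num.sqrt; congr (_ + _); rewrite -sqrrN opprB.
have shr : (\sum_(i < n) L1 (proj_strip (t i + r) (t i.+1 - r)) <= C%:E)%E.
  apply: (sep n P (fun i => proj_strip (t i + r) (t i.+1 - r)) r r0).
  - by move=> i p [].
  - by move=> i; exact: measurable_proj_strip.
  - by move=> i; exact: subset_refl.
  - move=> i j p q ij Pp Pq; move: ij; rewrite neq_ltn => /orP[ij|ji].
      exact: (sepP i j).
    by rewrite edistC; exact: (sepP j i).
have shr' : \sum_(i < n) `|g (t i.+1 - r) - g (t i + r)| <= C.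
  rewrite -lee_fin -sumEFin; apply: le_trans shr; apply: lee_sum => i _.
  by apply: section_length_diff; have := rt i; lra.
have : \sum_(i < n) `|g (t i.+1) - g (t i)| <=
    \sum_(i < n) (`|g (t i.+1 - r) - g (t i + r)| + 2 * e').
  apply: ler_sum => i _.
  have iS : (i.+1 < n.+1)%N by rewrite ltnS.
  have i0 : (i < n.+1)%N by rewrite ltnS ltnW.
  have h1 : `|g (t i.+1 - r) - g (t i.+1)| <= e'.
    have [_ h] := dP (Ordinal iS); apply: h => /=.
    by rewrite addrAC subrr sub0r normrN gtr0_norm// (rd (Ordinal iS)).
  have h2 : `|g (t i + r) - g (t i)| <= e'.
    have [_ h] := dP (Ordinal i0); apply: h => /=.
    by rewrite addrAC subrr add0r gtr0_norm// (rd (Ordinal i0)).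
  exact: norm_four_points h1 h2.
rewrite big_split/= sumr_const card_ord => /le_trans; apply.
rewrite lerD// -(mulr_natr (2 * e') n).
have z0 : 0 < n.+1%:R :> R by [].
have zn : n%:R <= n.+1%:R :> R by rewrite ler_nat.
rewrite /e'; move: z0 zn; set z : R := n.+1%:R => z0 zn.
have -> : 2 * (e / (2 * z)) * n%:R = e * (n%:R / z) by field; rewrite gt_eqF.
by rewrite ger_pMr// ler_pdivrMr// mul1r.
Qed.

Lemma section_length_BV (b c : R) : bounded_variation b c g.
Proof.
have [C CP] := section_length_variation.
exists C => _ [s [sp _] <-]; rewrite /variation big_mkord.
apply: (CP _ (fun n => nth c (b :: s) n)) => i si.
by move/pathP : sp; apply.
Qed.

Lemma measurable_slope (b : R) :
  measurable_fun setT ((fun p => p.1 + b * p.2) : RR * RR -> RR).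
Proof.
apply: measurable_funD => //.
by apply: measurableT_comp => //; exact: mulrl_measurable.
Qed.

Lemma measurable_strip (A : set RR) (b : R) : measurable A ->
  measurable ([set p | A (p.1 + b * p.2)] : set (RR * RR)).
Proof. by move=> mA; rewrite -[X in measurable X]setTI; exact: measurable_slope. Qed.

(** Shearing turns the lines of slope [a] into vertical lines. *)
Lemma borel2_line_sections (W : set (RR * RR)) : measurable W ->
  borel2 W = (\int[L1]_t L1 (line_section a W t))%E.
Proof.
move=> mW.
have mf : measurable_fun setT ((fun y => - a * y) : RR -> RR) by exact: mulrl_measurable.
have [_ <-] := borel2_hshear mW mf.
rewrite /borel2 /product_measure1; apply: eq_integral => t _ /=; congr (L1 _).
by apply/seteqP; split => y; rewrite /xsection /line_section /= !inE /= mulNr.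
Qed.

Lemma borel2_strip (A : set RR) : measurable A ->
  borel2 [set p | E° p /\ A (p.1 + a * p.2)] = (\int[L1]_(t in A) (g t)%:E)%E.
Proof.
move=> mA; rewrite borel2_line_sections; last first.
  by apply: measurableI => //; exact: measurable_strip.
rewrite [RHS]integral_mkcond; apply: eq_integral => t _; rewrite patchE.
case: ifPn => [|nA].
  rewrite inE => tA; rewrite section_lengthE; congr (L1 _).
  by apply/seteqP; split => y; rewrite /line_section/= subrK; [case|split].
transitivity (L1 set0); last by rewrite measure0.
congr (L1 _).
apply/seteqP; split => // y; rewrite /line_section/= subrK => -[_ tA].
by move: nA; rewrite notin_setE; apply.
Qed.

Lemma borel2_interior : borel2 E° = (\int[L1]_t (g t)%:E)%E.
Proof.
rewrite -(borel2_strip measurableT); congr borel2.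
by apply/seteqP; split => p; [split|case].
Qed.

Lemma borel2_interior_fin : (borel2 E° < +oo)%E.
Proof.
pose I : set RR := `[- M, M]%classic.
have mI : measurable I by exact: measurable_itv.
apply: (@le_lt_trans _ _ (borel2 (I `*` I))).
  apply: le_measure; rewrite ?inE => //; first exact: measurableX.
  by move=> p /iE[h1 h2]; split; rewrite /I/= in_itv/= -ler_norml.
rewrite /borel2 product_measure1E//.
have fI : (L1 I < +oo)%E by exact/compact_finite_measure/segment_compact.
by rewrite lte_mul_pinfty// ge0_fin_numE.
Qed.

Lemma section_length_integrable (A : set RR) : measurable A -> L1.-integrable A (EFin \o g).
Proof.
move=> mA; apply: (@integrableS _ _ _ L1 setT) => //.
apply/integrableP; split.
  apply/measurable_EFinP; apply: continuous_measurable_fun.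
  exact: section_length_continuous.
have -> : (\int[L1]_x `|(EFin \o g) x| = borel2 E°)%E.
  rewrite borel2_interior; apply: eq_integral => t _ /=.
  by rewrite ger0_norm// section_length_ge0.
exact: borel2_interior_fin.
Qed.

Definition primitive (x : R) : R := (\int[L1]_(t in `]-oo, x]) g t)%R.

Lemma primitive_derive (x : R) : is_derive x 1 primitive (g x).
Proof.
have [||||d e] := @continuous_FTC1 R g -oo%O x (x + 1).
- lra.
- by apply: section_length_integrable; exact: measurable_itv.
- by rewrite /= ltNyr.
- exact: section_length_continuous.
- by apply: DeriveDef; [exact: d|rewrite -derive1E; exact: e].
Qed.

Lemma borel2_band (c d : R) : c <= d ->
  borel2 [set p | E° p /\ (p.1 + a * p.2) \in `]c, d]] = (primitive d - primitive c)%:E.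
Proof.
move=> cd; rewrite (borel2_strip (A := `]c, d]%classic)); last exact: measurable_itv.
rewrite /primitive Rintegral_itvB//; last first.
  by apply: section_length_integrable; exact: measurable_itv.
rewrite /Rintegral fineK//.
apply: integrable_fin_num; first exact: measurable_itv.
by apply: section_length_integrable; exact: measurable_itv.
Qed.

(** * The test set of a slope *)

Hypothesis Epos : (0 < borel2 E°)%E.

Lemma section_length_pos : exists t, 0 < g t.
Proof.
apply/not_existsP => h; move: Epos.
rewrite (borel2_interior) integral0_eq ?ltxx// => t _.
congr EFin; apply/le_anti; rewrite section_length_ge0 andbT leNgt.
exact/negP/h.
Qed.

(** The width [eta] is a unit of length in which g is bounded below by a
    constant on a unit interval. The affine coordinate [ell] takes its values on
    the interior of [E] in ]0, 2 * m[, and a translation by [z] adds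
    (z.1 + a * z.2) / eta to it. *)
Lemma slope_test_set : exists2 T : set (RR * RR), measurable T &
  forall z z' : R * R,
  borel2 [set q | E° q /\ T (q + z)] = borel2 [set q | E° q /\ T (q + z')] ->
  z.1 + a * z.2 = z'.1 + a * z'.2.
Proof.
have [t0 t0P] := section_length_pos.
pose c := g t0 / 2.
have c0 : 0 < c by rewrite divr_gt0.
have [eta eta0 etaP] := section_length_modulus t0 c0.
have gc t : t0 <= t <= t0 + eta -> c <= g t.
  by move=> /andP[t1 t2]; apply/half_close/etaP; rewrite ger0_norm; lra.
pose m := (Num.truncn ((2 * `|M| + 1) / eta)).+1.
pose K := eta * m%:R.
have KM : 2 * M < K.
  have : (2 * `|M| + 1) / eta < m%:R by exact: truncnS_gt.
  rewrite ltr_pdivrMr// (mulrC m%:R) -/K; have := ler_norm M; lra.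
have gz t : K <= `|t| -> g t = 0.
  by move=> Kt; apply: section_length0; exact: lt_le_trans KM Kt.
have cg := section_length_continuous.
have bvg := section_length_BV (- K) K.
have m0 : (0 < m)%N by [].
have [phi [phim phic phiu phiE]] := scaled_decomposition eta0 (erefl : K = eta * m%:R) m0 cg bvg gz.
pose aff (x : R) : R := eta * (x - m%:R).
pose gs (x : R) : R := eta * g (aff x).
have gsz x : x <= 0 \/ (2 * m)%N%:R <= x -> gs x = 0.
  move=> xo; rewrite /gs gz ?mulr0// /aff normrM gtr0_norm// ler_pM2l//.
  case: xo => [x0|xQ].
    by rewrite distrC (le_trans _ (ler_norm _))//; lra.
  by rewrite (le_trans _ (ler_norm _))//; rewrite natrM in xQ; lra.
have ec0 : 0 < eta * c by rewrite mulr_gt0.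
have gsc x : t0 / eta + m%:R <= x <= t0 / eta + m%:R + 1 -> eta * c <= gs x.
  move=> /andP[x1 x2]; apply: ler_wpM2l; first exact: ltW.
  apply: gc.
  have t0E : eta * (t0 / eta) = t0 by rewrite mulrC divfK// gt_eqF.
  have h1 : eta * (t0 / eta) <= eta * (x - m%:R) by rewrite ler_pM2l//; lra.
  have h2 : eta * (x - m%:R) <= eta * (t0 / eta + 1) by rewrite ler_pM2l//; lra.
  by rewrite (mulrDr eta (t0 / eta) 1) mulr1 t0E in h2; rewrite t0E in h1; apply/andP.
have gs0 x : 0 <= gs x by rewrite mulr_ge0 ?section_length_ge0// ltW.
have Q0 : (0 < 2 * m)%N by [].
have [N N0 NP] := exists_increasing_pattern phim phic phiu Q0 phiE gs0 gsz ec0 gsc.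
pose ell (p : RR * RR) : RR := (p.1 + a * p.2) / eta + m%:R.
have mell : measurable_fun setT ell.
  apply: measurable_funD => //.
  apply: (measurableT_comp (f := fun x : RR => (x / eta : RR))); last exact: measurable_slope.
  exact: mulrr_measurable.
have [nu nuE] : exists nu : {measure set RR -> \bar R},
    forall A, nu A = borel2 [set p | E° p /\ A (ell p)].
  exists (measure_function_pushforward__canonical__measure_function_Measure
    (mrestr (@borel2 R) mU) mell) => A.
  by rewrite /= /pushforward /mrestr setIC.
pose G (x : R) := primitive (aff x).
have dG (x : R) : is_derive x 1 G (gs x).
  have da : is_derive x 1 aff eta.
    have := is_deriveZ eta (is_deriveB (is_derive_id x 1) (is_derive_cst (m%:R : R) x 1)).
    by rewrite subr0 /GRing.scale/= mulr1.
  have := @is_derive1_comp _ primitive aff x _ _ (primitive_derive _) da.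
  by rewrite mulrC.
have affl (x t : R) : (aff x < t) = (x < t / eta + m%:R).
  by rewrite /aff mulrC -ltr_pdivlMr// ltrBlDr.
have affr (x t : R) : (t <= aff x) = (t / eta + m%:R <= x).
  by rewrite /aff mulrC -ler_pdivrMr// lerBrDr.
have nu_itv (b d : R) : b <= d -> nu `]b, d]%classic = (G d - G b)%:E.
  move=> bd; rewrite nuE -borel2_band; last first.
    by rewrite /aff ler_pM2l// lerD2r.
  congr borel2; apply/seteqP; split => p [Ep];
    by rewrite /= !in_itv/= affl affr; split.
have ellM p : E° p -> `|p.1 + a * p.2| <= 2 * M.
  move=> /iE[h1 h2]; apply: le_trans (ler_normD _ _) _.
  have /andP[a0 a1] := a01.
  have : `|a * p.2| <= M by rewrite normrM ger0_norm// (le_trans _ h2)// ler_piMl.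
  lra.
have nu0 : nu (~` `]0, (2 * m)%N%:R]%classic) = 0%E.
  rewrite nuE; transitivity (borel2 (set0 : set (RR * RR))); last by rewrite measure0.
  congr borel2; apply/seteqP; split => // p [Ep] /=; apply.
  have := ellM p Ep; rewrite ler_norml in_itv/= /ell natrM => /andP[h1 h2].
  have h3 : - m%:R < (p.1 + a * p.2) / eta.
    by rewrite ltr_pdivlMr// mulNr mulrC -/K; lra.
  have h4 : (p.1 + a * p.2) / eta < m%:R.
    by rewrite ltr_pdivrMr// (mulrC m%:R) -/K; lra.
  move: h3 h4; set v := _ / eta => h3 h4; clear h1 h2.
  by apply/andP; split; lra.
have incr := pattern_increasing dG NP nu_itv nu0.
exists [set p | pattern N (ell p)].
  by rewrite -[X in measurable X]setTI; apply: mell => //; exact: measurable_pattern.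
have testE (z : R * R) : borel2 [set q | E° q /\ pattern N (ell (q + z))] =
    nu [set t | pattern N (t + (z.1 + a * z.2) / eta)].
  rewrite nuE; congr borel2; apply/seteqP; split => q [Eq] /=.
    by have -> : ell (q + z) = ell q + (z.1 + a * z.2) / eta by rewrite /ell /=; ring.
  by have -> : ell (q + z) = ell q + (z.1 + a * z.2) / eta by rewrite /ell /=; ring.
move=> z z' e.
have : nu [set t | pattern N (t + (z.1 + a * z.2) / eta)] =
       nu [set t | pattern N (t + (z'.1 + a * z'.2) / eta)].
  by rewrite -!testE; exact: e.
have i0 : eta^-1 != 0 by apply: invr_neq0; exact: lt0r_neq0.
have [lt|lt|eq] := ltgtP ((z.1 + a * z.2) / eta) ((z'.1 + a * z'.2) / eta).
- by move=> e'; have := incr _ _ lt; rewrite e' ltxx.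
- by move=> e'; have := incr _ _ lt; rewrite e' ltxx.
- by move=> _; exact: (mulIf i0 eq).
Qed.
End line_sections.

(** * Reconstruction of translates *)

Section plane_sets.
Context {R : realType}.
Local Notation RR := (measurableTypeR R).
Local Notation L1 := (@lebesgue_measure R).

Lemma bounded_closure_box (E : set (R * R)) : bounded_set E ->
  exists M : R, forall p, closure E p -> `|p.1| <= M /\ `|p.2| <= M.
Proof.
move=> [M0 [_ /(_ (M0 + 1))]]; rewrite ltrDl ltr01 => /(_ isT) EM.
pose M := M0 + 1.
exists M; pose I : set R := `[- M, M]%classic.
have cI : closed (I `*` I).
  apply: closedI.
    by apply: closed_comp => [p _|]; [exact: cvg_fst|exact: itv_closed].
  by apply: closed_comp => [p _|]; [exact: cvg_snd|exact: itv_closed].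
have EI : E `<=` I `*` I.
  move=> p /EM /=; rewrite prod_normE /= ge_max => /andP[h1 h2].
  by split; rewrite /I/= in_itv/= -ler_norml.
have cEI : closure E `<=` I `*` I.
  by have := closure_subset EI; rewrite -((closure_id _).1 cI).
by move=> p /cEI; rewrite /I /setX/= !in_itv/= -!ler_norml.
Qed.

Lemma measurable_boundary (E : set (R * R)) : measurable (boundary E : set (RR * RR)).
Proof.
rewrite -[X in measurable X]setCK; apply: measurableC; apply: open_borel2.
by apply: closed_openC; exact: closed_boundary.
Qed.

(** Up to the translate of the null boundary, the translate of [E] is that of
    its interior; translating back by [x] moves [T] instead. *)
Lemma lebesgue2_translate_test (E : set (R * R)) (T : set (RR * RR)) (x : R * R) :
  borel2 (boundary E) = 0%E -> measurable T ->
  lebesgue2 ([set p + x | p in E] `&` T) = borel2 [set q | E° q /\ T (q + x)].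
Proof.
move=> b0 mT.
have mU : measurable (E° : set (RR * RR)) by apply: open_borel2; exact: open_interior.
have [mUx _] := borel2_translate (- x) mU.
have [mBx Bx] := borel2_translate (- x) (measurable_boundary E).
pose W : set (RR * RR) := [set p | E° (p - x)] `&` T.
have mW : measurable W by exact: measurableI.
have -> : borel2 [set q | E° q /\ T (q + x)] = borel2 W.
  rewrite -(borel2_translate x mW).2; congr borel2.
  by apply/seteqP; split => q /=; rewrite /W /= addrK.
have eW := lebesgue2_borel mW.
apply/le_anti/andP; split; last first.
  rewrite -[X in (X <= _)%E]eW; apply: le_outer_measure => p [Up Tp].
  split; last exact: Tp.
  by exists (p - x); [exact: interior_subset Up|rewrite subrK].
have Bx0 := etrans Bx b0.
have eWB := etrans (lebesgue2_borel (measurableU _ _ mW mBx)) (measureU0 mW mBx Bx0).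
rewrite -[X in (_ <= X)%E]eWB.
apply: le_outer_measure => p [[q Eq <-] Tq].
have [Uq|nUq] := pselect (E° q); [left|right] => /=.
  by split; [rewrite /= addrK|exact: Tq].
by rewrite addrK; split; [exact: subset_closure|exact: nUq].
Qed.

End plane_sets.

Unset Implicit Arguments.

Theorem corollary5p16 (R : realType) (E : set (R * R)) :
  bounded_set E ->
  lebesgue2_measurable E ->
  (0 < lebesgue2 E)%E ->
  rectifiable (boundary E) ->
  (hausdorff1 (boundary E) < +oo)%E ->
  reconstructible 2 (translates E).
Proof.
move=> bddE _ posE _ Hoo.
have [M clM] := bounded_closure_box bddE.
have bE p : boundary E p -> `|p.1| <= M /\ `|p.2| <= M by case=> /clM.
have iE p : E° p -> `|p.1| <= M /\ `|p.2| <= M.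
  by move=> /interior_subset /subset_closure /clM.
have mB := measurable_boundary E.
have [a [b [a01 b01 ab nulla nullb]]] := two_null_slopes Hoo mB.
have B0 : borel2 (boundary E) = 0%E.
  by rewrite (borel2_line_sections a mB) integral0_eq.
have mU : measurable (E° : set (measurableTypeR R * measurableTypeR R)).
  by apply: open_borel2; exact: open_interior.
have posU : (0 < borel2 E°)%E.
  apply: lt_le_trans posE _.
  have eUB := etrans (lebesgue2_borel (measurableU _ _ mU mB)) (measureU0 mU mB B0).
  rewrite -[X in (_ <= X)%E]eUB.
  apply: le_outer_measure => p Ep.
  have [Up|nUp] := pselect (E° p); [by left|right].
  by split; [exact: subset_closure|exact: nUp].
have [Ta mTa Pa] := slope_test_set a01 bE iE Hoo nulla posU.
have [Tb mTb Pb] := slope_test_set b01 bE iE Hoo nullb posU.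
exists (fun i : 'I_2 => if i == ord0 then Ta else Tb); split.
  by move=> i; apply: sub_caratheodory; apply: sub_sigma_algebra; case: ifP.
move=> _ _ [x _ <-] [x' _ <-] same.
have ea : x.1 + a * x.2 = x'.1 + a * x'.2.
  apply: Pa; rewrite -(lebesgue2_translate_test x B0 mTa).
  by rewrite -(lebesgue2_translate_test x' B0 mTa); exact: same ord0.
have eb : x.1 + b * x.2 = x'.1 + b * x'.2.
  apply: Pb; rewrite -(lebesgue2_translate_test x B0 mTb).
  by rewrite -(lebesgue2_translate_test x' B0 mTb); exact: same ord_max.
have e2 : x.2 = x'.2.
  have : (a - b) * (x.2 - x'.2) = 0.
    have -> : (a - b) * (x.2 - x'.2) = (x.1 + a * x.2) - (x.1 + b * x.2) -
      ((x'.1 + a * x'.2) - (x'.1 + b * x'.2)) by ring.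
    by rewrite ea eb subrr.
  move=> /eqP; rewrite mulf_eq0 !subr_eq0 (negbTE ab) => /eqP //.
have e1 : x.1 = x'.1 by apply: (addIr (a * x.2)); rewrite ea e2.
by have -> : x = x' by rewrite [x]surjective_pairing [x']surjective_pairing e1 e2.
Qed.
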